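(* For every integer $g\ge 1$, the diameter $D_g$ of the surgery graph $K_g$ satisfies $$D_g\le 3g^2+9g-12.$$
   Context: $\Sigma_g$ denotes a closed oriented surface of genus $g\ge 1$. A collection $\Gamma$ of closed curves on $\Sigma_g$ in generic position (only transverse double points) is regarded as a 4-valent graph embedded in $\Sigma_g$: vertices are the intersection points, edges are the arcs between them. It is one-faced if $\Sigma_g\setminus\Gamma$ is a single open disk. Cutting $\Sigma_g$ along a one-faced $\Gamma$ gives a polygon $P_\Gamma$ with $8g-4$ sides; each edge of $\Gamma$ gives two sides, and the sides of $P_\Gamma$ are called the oriented edges of $\Gamma$ ($x$ and $\bar x$ denote the two sides of the same edge). Surgery: let $x,y$ be two oriented edges of a one-faced collection $\Gamma$ belonging to distinct edges of $\Gamma$. Let $\lambda_{x,y}$ be the simple arc, unique up to homotopy, whose interior is disjoint from $\Gamma$ (it lies in the interior of $P_\Gamma$) and which joins an interior point of the side $x$ to an interior point of the side $y$. The collection $\sigma_{x,y}(\Gamma)$ is obtained by cutting open $\Gamma$ along $\lambda_{x,y}$: remove from each of the two edges a small open subarc around the endpoint of $\lambda_{x,y}$, and join the four resulting ends by two disjoint parallel copies of $\lambda_{x,y}$, one on each side of $\lambda_{x,y}$. When $\sigma_{x,y}(\Gamma)$ is one-faced, the operation $\Gamma\to\sigma_{x,y}(\Gamma)$ is called a surgery. The surgery graph $K_g$ has as vertices the homeomorphism classes of one-faced collections on $\Sigma_g$ (two collections are identified if a homeomorphism of $\Sigma_g$ maps one to the other); two distinct vertices are joined by an edge if they have representatives connected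 by a surgery. $D_g$ is the diameter of $K_g$ for the graph distance (each edge has length 1). *)

(* Defs.v *)
From HB Require Import structures.
From mathcomp Require Import all_boot all_order all_algebra all_fingroup.
From mathcomp Require Import zify constructive_ereal.

Set Implicit Arguments.
Unset Strict Implicit.
Unset Printing Implicit Defensive.

Import Order.TTheory GRing.Theory Num.Theory.

(** * Graphs embedded in closed oriented surfaces

    A graph cellularly embedded in a closed oriented surface is encoded, up to
    homeomorphism, by its rotation system.  A dart is an oriented edge [x]; it
    stands both for the half-edge at the origin of [x] and for the side [x] of
    a complementary region, the one lying to the left of [x].  Then
    - [edge] sends [x] to the same edge with the opposite orientation, which is
      the side written "x bar";
    - [node] turns counterclockwise around the origin of [x];
    - [face] sends the side [x] to the next side of the region to its left:
      one arrives along [x], i.e. at the half-edge [edge x], and leaves by the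
      next half-edge clockwise.
    Vertices, edges and complementary regions are the cycles of [node], [edge]
    and [face]. *)

Definition emap (D : finType) : finType := ({perm D} * {perm D})%type.

Section EmbeddedGraphs.
Variable D : finType.
Implicit Types (G H : emap D) (x y : D).

Definition edge G : {perm D} := G.1.
Definition node G : {perm D} := G.2.
(* Products of permutations are read from left to right. *)
Definition face G : {perm D} := (edge G * (node G)^-1)%g.

Lemma faceE G x : face G x = (node G)^-1%g (edge G x).
Proof. by rewrite permM. Qed.

Definition euler_char G : int :=
  (#|porbits (node G)|%:Z - #|porbits (edge G)|%:Z + #|porbits (face G)|%:Z)%R.

(* A collection of closed curves with only transverse double points is a
   4-valent graph: the curves are recovered by going straight ahead at each
   vertex, i.e. along [node G \o node G].  A closed curve through no double
   point is not represented: a one-faced collection is connected, so it would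
   consist of that curve alone, whose complement in a closed surface of genus
   [g > 0] is not a disk. *)
Definition curve_collection G : bool :=
  [forall x, (edge G (edge G x) == x) && (edge G x != x)]
  && [forall x, #|porbit (node G) x| == 4].

Definition one_faced G : bool :=
  curve_collection G && (#|porbits (face G)| == 1).

Lemma card_porbits_uniform (s : {perm D}) k :
  (forall x, #|porbit s x| = k) -> #|D| = #|porbits s| * k.
Proof.
move=> sk; pose P := porbits s.
have partP : partition P [set: D].
  apply/and3P; split.
  - rewrite eqEsubset subsetT; apply/subsetP=> x _; apply/bigcupP.
    by exists (porbit s x); [exact: imset_f | exact: porbit_id].
  - apply/trivIsetP=> _ _ /imsetP[x _ ->] /imsetP[y _ ->] neq.
    apply/pred0P=> z /=; apply/negP=> /andP[zx zy].
    by move: neq; rewrite -(eqP (etrans (eq_porbit_mem s z x) zx))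
      -(eqP (etrans (eq_porbit_mem s z y) zy)) eqxx.
  - by apply/negP=> /imsetP[x _ E]; have := porbit_id s x; rewrite -E inE.
rewrite -cardsT; apply: card_uniform_partition partP => _ /imsetP[x _ ->].
exact: sk.
Qed.

(* The genus of a one-faced collection is determined by the number of sides of
   the polygon obtained by cutting along it. *)
Lemma one_faced_genus G g :
  0 < g -> one_faced G -> (euler_char G == 2 - 2 * g%:Z)%R = (#|D| == 8 * g - 4).
Proof.
move=> g_gt0 /andP[/andP[/forallP eG /forallP nG] /eqP f1].
have n4 := card_porbits_uniform (fun x => eqP (nG x)).
have /card_porbits_uniform e2 x : #|porbit (edge G) x| = 2.
  case/andP: (eG x) => /eqP eK eN.
  suff -> : porbit (edge G) x = [set x; edge G x] by rewrite cards2 eq_sym eN.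
  apply/setP=> y; rewrite !inE; apply/idP/idP => [/porbitP[i ->]|].
    elim: i => [|i]; first by rewrite expg0 perm1 eqxx.
    by rewrite expgSr permM => /orP[] /eqP ->; rewrite ?eK eqxx ?orbT.
  by case/orP=> /eqP ->; [exact: porbit_id | exact: (mem_porbit _ 1)].
rewrite /euler_char f1; lia.
Qed.

(** * Homeomorphisms *)

(* The first alternative is a homeomorphism preserving the orientation, the
   second one a homeomorphism reversing it. *)
Definition homeo G H : bool :=
  [exists f : {perm D}, (edge H == edge G ^ f)%g
    && ((node H == node G ^ f)%g || (node H == (node G)^-1 ^ f)%g)].

Lemma homeo_refl G : homeo G G.
Proof. by apply/existsP; exists 1%g; rewrite !conjg1 !eqxx. Qed.

Lemma homeo_sym G H : homeo G H -> homeo H G.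
Proof.
case/existsP=> f /andP[/eqP eH nH]; apply/existsP; exists f^-1%g.
rewrite eH conjgK eqxx /=.
by case/orP: nH => /eqP ->; rewrite ?conjVg ?invgK conjgK eqxx ?orbT.
Qed.

Lemma homeo_trans G H K : homeo G H -> homeo H K -> homeo G K.
Proof.
case/existsP=> f /andP[/eqP eH nH] /existsP[h /andP[/eqP eK nK]].
apply/existsP; exists (f * h)%g; rewrite !conjgM eK eH eqxx /=.
by case/orP: nK => /eqP ->; case/orP: nH => /eqP ->;
  rewrite -?conjVg ?invgK eqxx ?orbT.
Qed.

Definition homeo_class G : {set emap D} := [set H | homeo G H].

(** * Surgery *)

(* Going around the polygon, the side [x] runs from the half-edge [x] to the
   half-edge [edge x], and then the side [y] from [y] to [edge y].  One parallel
   copy of the arc from [x] to [y] joins the end of [x] to the origin of [y],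
   the other one joins the end of [y] to the origin of [x]; see [surgeryE].
   The vertices and the cyclic orders around them are unchanged. *)
Definition surgery G x y : emap D :=
  ((edge G ^ tperm (edge G x) (edge G y))%g, node G).

Lemma surgeryE G x y (e := edge G) (e' := edge (surgery G x y)) :
  curve_collection G -> y != x -> y != e x ->
  [/\ e' (e x) = y, e' y = e x, e' (e y) = x, e' x = e y
    & forall z, z \notin [:: x; e x; y; e y] -> e' z = e z].
Proof.
case/andP=> /forallP eG _ yx yex.
have eK z : e (e z) = z by case/andP: (eG z) => /eqP.
have eN z : e z != z by case/andP: (eG z).
have xey : x != e y by apply: contra_neq yex => ->; rewrite eK.
have e'E z : e' z = tperm (e x) (e y) (e (tperm (e x) (e y) z)).
  by rewrite /e' /= -[z in LHS](tpermK (e x) (e y)) permJ.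
split=> [||||z].
- by rewrite e'E tpermL eK tpermD // eq_sym.
- by rewrite e'E (tpermD _ (eN y)) ?tpermR // eq_sym.
- by rewrite e'E tpermR eK tpermD // eq_sym.
- by rewrite e'E (tpermD (eN x)) ?tpermL // eq_sym.
rewrite !inE !negb_or => /and4P[zx zex zy zey].
by rewrite e'E !tpermD // 1?eq_sym // (inj_eq perm_inj).
Qed.

(* Cutting and rejoining takes place in the surface of [G], whereas the cycles
   of [face (surgery G x y)] are the boundary components of a neighbourhood of
   the new collection.  If there is only one, the complement of the collection
   has connected boundary and, vertices and edges being as many as before,
   Euler characteristic 1: it is a disk.  Conversely a disk has one boundary
   component. *)
Definition is_surgery G H : bool :=
  [&& one_faced G, one_faced H &
    [exists x, exists y, [&& y != x, y != edge G x & H == surgery G x y]]].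

End EmbeddedGraphs.

(** * Distance and diameter in a finite graph, possibly disconnected *)

Section Diameter.
Variables (V : finType) (e : rel V).

Definition walk (x y : V) (n : nat) : bool :=
  [exists p : n.-tuple V, path e x p && (last x p == y)].

Lemma connect_walk x y : connect e x y -> exists n, walk x y n.
Proof.
case/connectP=> p ep ->; exists (size p); apply/existsP.
by exists (in_tuple p); rewrite ep eqxx.
Qed.

Definition dist (x y : V) : \bar int :=
  if @idP (connect e x y) is ReflectT cxy
  then (Posz (ex_minn (connect_walk cxy)))%:E%E else +oo%E.

Definition diameter : \bar int :=
  \big[maxe/0%E]_(x : V) \big[maxe/0%E]_(y : V) dist x y.

End Diameter.

(** * The surgery graph *)

Section SurgeryGraph.
Variable g : nat.

(* By [one_faced_genus], the one-faced collections on the surface of genus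
   [g > 0] are the one-faced [G] with [8 * g - 4] darts, which may be numbered
   arbitrarily. *)
Definition oriented_edge : finType := 'I_(8 * g - 4).

Definition collection_classes : {set {set emap oriented_edge}} :=
  [set homeo_class G | G in @one_faced oriented_edge].

Definition surgery_vertex : finType := {C | C \in collection_classes}.

Definition surgery_adj : rel surgery_vertex := fun C1 C2 =>
  (C1 != C2) &&
  [exists G in val C1, exists H in val C2, is_surgery G H || is_surgery H G].

Definition surgery_diameter : \bar int := diameter surgery_adj.

End SurgeryGraph.

(* Main.v *)
(** Read the boundary of the polygon of a one-faced collection as a cyclic word
    in which each side [x] occurs once, as does the other side [x'] of its edge.
    Surgeries are then the moves [x A x' B y C y' D -> x C x' B y A y' D].
    Two moves produce a factor [p b p'], i.e. an edge [b] that is a simple closed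
    curve with one double point; three more make the word contain
    [p b p' q b' q'], a handle hanging in the middle of a side of a one-faced
    collection of genus [g - 1].  Moves of the smaller collection lift, so by
    induction it can be brought to a standard form, with the handle hanging on
    an unknown side; a handle slides between the sides of unlinked edges in two
    moves, and two slides bring it to the standard side.  Hence every collection
    is at distance at most [(2 + 3 + 4) (g - 1)] from the standard one, and
    [18 (g - 1) <= 3 (g - 1) (g + 4) = 3 g^2 + 9 g - 12] for [g >= 2]. *)

Require Import Defs.
From mathcomp Require Import all_boot all_order all_algebra.
From mathcomp Require Import constructive_ereal.
From mathcomp Require Import all_fingroup zify.

Set Implicit Arguments.
Unset Strict Implicit.
Unset Printing Implicit Defensive.

Import Order.TTheory GRing.Theory Num.Theory.

(** * Cyclic words and moves *)

Section FunctionCycles.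
Variable T : eqType.
Implicit Types (f : T -> T) (x y z : T) (A B C D w : seq T).

(** The start of a path matters only through its first step, so [f'] from [x] follows the path of
    [f] from [y]. *)
Lemma path_first_step f f' x y A z :
  f' x = f y -> {in A, f' =1 f} ->
  path (frel f') x (rcons A z) = path (frel f) y (rcons A z).
Proof.
elim: A x y => [|a A IH] x y /= E fA; first by rewrite E.
by rewrite E (IH a a) ?fA ?mem_head // => b bA; rewrite fA // inE bA orbT.
Qed.

Lemma fcycle_four_blocks f x A x' B y C y' D :
  fcycle f (x :: A ++ x' :: B ++ y :: C ++ y' :: D) =
  [&& path (frel f) x (rcons A x'), path (frel f) x' (rcons B y),
      path (frel f) y (rcons C y') & path (frel f) y' (rcons D x)].
Proof.
rewrite /= !rcons_cat /= !rcons_cat /= !rcons_cat /=.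
by rewrite -!cat_rcons !cat_path !last_rcons.
Qed.

(** Exchanging the successors of [x] and [y], and those of [x'] and [y'], reconnects the four blocks
    in the order [C], [B], [A], [D]. *)
Lemma fcycle_swap_blocks f f' x A x' B y C y' D :
  {in A ++ B ++ C ++ D, f' =1 f} ->
  f' x = f y -> f' y = f x -> f' x' = f y' -> f' y' = f x' ->
  fcycle f (x :: A ++ x' :: B ++ y :: C ++ y' :: D) ->
  fcycle f' (x :: C ++ y' :: B ++ y :: A ++ x' :: D).
Proof.
move=> ff' fx fy fx' fy'; rewrite !fcycle_four_blocks => /and4P[pA pB pC pD].
by rewrite (path_first_step _ fx) ?(path_first_step _ fy) ?(path_first_step _ fx')
  ?(path_first_step _ fy') ?pA ?pB ?pC // => z zA; apply: ff';
  rewrite !mem_cat zA ?orbT.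
Qed.

Lemma fcycle_next f w A x y B : fcycle f w -> w = A ++ x :: y :: B -> f x = y.
Proof. by move=> + wE; rewrite {}wE cycle_catC /= => /andP[/eqP]. Qed.

Lemma fcycle_last f w A x y : fcycle f w -> w = y :: A ++ [:: x] -> f x = y.
Proof.
by move=> + wE; rewrite {}wE /= -cats1 -catA cat_path /= => /andP[_ /andP[_ /andP[/eqP]]].
Qed.

End FunctionCycles.

(** Membership and uniqueness are handled through letter counts, so that clashes between letters
    become linear arithmetic. *)
Lemma uniq_count_le1 (T : eqType) (w : seq T) : uniq w -> forall a, count_mem a w <= 1.
Proof. by move=> u a; rewrite count_uniq_mem // leq_b1. Qed.

Lemma mem_count_mem (T : eqType) (a : T) w : (a \in w) = (0 < count_mem a w).
Proof. by rewrite -has_pred1 has_count. Qed.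

Ltac count_simpl := repeat (progress (rewrite /= -?cats1 ?count_cat ?eqxx)).
Ltac count_lia :=
  count_simpl;
  repeat lazymatch goal with |- context [nat_of_bool ?b] => generalize (nat_of_bool b) end;
  repeat lazymatch goal with |- context [count ?p ?s] => generalize (count p s) end;
  clear; lia.
(* Refutes the double occurrence of the letter [a] in a word with [u : uniq w]. *)
Ltac dup u a := exfalso; move: (uniq_count_le1 u a); count_lia.
Ltac word_eq := repeat (progress (rewrite /= -?catA ?cat_rcons ?cats0 -?cats1)); reflexivity.

Section Words.
Variables (T : eqType) (bar : T -> T).
Hypotheses (barK : involutive bar) (barN : forall x, bar x != x).
Implicit Types (x y z : T) (A B C D w : seq T).

(* Refutes, in a word with [u : uniq w] in which [z] occurs, that [bar z] is one
   of the occurrences [v] or [bar v] given by the disjunction on the goal. *)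
Ltac not_partner u z :=
  rewrite /= ?orbF; repeat case/orP;
  (let E := fresh "E" in move/eqP=> E; exfalso;
   lazymatch type of E with
   | _ = ?f ?v => let E' := fresh "E" in have E' := inv_inj barK E; rewrite -E' in u
   | _ => rewrite -E in u
   end; rewrite ?barK in u; dup u z).

(* [ReachMove] is the surgery along [x] and [y], followed by the exchange of the
   names [bar x] and [bar y], so that [bar] remains the same. *)
Inductive reach : nat -> seq T -> seq T -> Prop :=
| Reach0 n w : reach n w w
| ReachRot n U V w : reach n (V ++ U) w -> reach n (U ++ V) w
| ReachMove n x A B y C D w :
    reach n (x :: C ++ bar x :: B ++ y :: A ++ bar y :: D) w ->
    reach n.+1 (x :: A ++ bar x :: B ++ y :: C ++ bar y :: D) w.

Lemma reach_trans n1 n2 w1 w2 w3 :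
  reach n1 w1 w2 -> reach n2 w2 w3 -> reach (n1 + n2) w1 w3.
Proof.
move=> r; elim: r => {n1 w1 w2} [n w|n U V w _ IH|n x A B y C D w _ IH] r.
- elim: r => {n2 w3 w} [m w|m U V w _ IH|m x A B y C D w _ IH].
  + exact: Reach0.
  + exact: ReachRot.
  + by rewrite addnS; apply: ReachMove.
- by apply: ReachRot; apply: IH.
- by apply: ReachMove; apply: IH.
Qed.

Lemma reach_leq n m w w' : n <= m -> reach n w w' -> reach m w w'.
Proof. by move=> /subnK <- r; rewrite addnC; apply: reach_trans r (Reach0 _ _). Qed.

(* [m] is the inverse of the rotation around the vertices, which have degree 4. *)
Definition good w :=
  [/\ uniq w, {in w, forall x, bar x \in w}
    & exists2 m : T -> T, fcycle (m \o bar) w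
      & {in w, forall x, m (m (m (m x))) = x /\ m (m x) != x}].

Lemma good_rot U V : good (U ++ V) -> good (V ++ U).
Proof.
case=> u c [m fm qm]; split; first by rewrite uniq_catC.
- by move=> x; rewrite !(mem_cat x) orbC -mem_cat => /c; rewrite !mem_cat orbC.
- exists m; first by rewrite cycle_catC.
  by move=> x; rewrite mem_cat orbC -mem_cat => /qm.
Qed.

Lemma good_vertex_closed w m : {in w, forall x, bar x \in w} ->
  fcycle (m \o bar) w -> {in w, forall x, m x \in w}.
Proof. by move=> c fm x /c xw; have /= := mem_fcycle fm xw; rewrite barK. Qed.

Lemma perm_move x A x' B y C y' D :
  perm_eq (x :: A ++ x' :: B ++ y :: C ++ y' :: D) (x :: C ++ x' :: B ++ y :: A ++ y' :: D).
Proof. by apply/seq.permP=> p; count_lia. Qed.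

Definition transpose (a c z : T) := if z == a then c else if z == c then a else z.

Lemma transposeK a c : involutive (transpose a c).
Proof.
move=> z; rewrite {2}/transpose; case: eqP => [->|/eqP za].
  by rewrite /transpose eqxx; case: eqP.
case: eqP => [->|/eqP zc]; first by rewrite /transpose eqxx.
by rewrite /transpose (negPf za) (negPf zc).
Qed.

(** Surgery conjugates [bar] by [t], which exchanges successors as in [fcycle_swap_blocks]. Renaming
    the letters by [t] restores [bar] and conjugates [m] instead. *)
Lemma fcycle_move m x A B y C D (t := transpose (bar x) (bar y)) :
  uniq (x :: A ++ bar x :: B ++ y :: C ++ bar y :: D) ->
  fcycle (m \o bar) (x :: A ++ bar x :: B ++ y :: C ++ bar y :: D) ->
  fcycle (t \o m \o t \o bar) (x :: C ++ bar x :: B ++ y :: A ++ bar y :: D).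
Proof.
move=> u fm.
have xy : x != y by apply/eqP=> E; subst y; dup u x.
have x'y : bar x != y by apply/eqP=> E; subst y; dup u (bar x).
have xy' : x != bar y by apply/eqP=> E; subst x; dup u (bar y).
have tK : involutive t := transposeK _ _.
have tx' : t (bar x) = bar y by rewrite /t /transpose eqxx.
have ty' : t (bar y) = bar x by rewrite -tx' tK.
have tid z : z != bar x -> z != bar y -> t z = z.
  by move=> /negPf zx /negPf zy; rewrite /t /transpose zx zy.
have tx : t x = x by rewrite tid // eq_sym.
have ty : t y = y by rewrite tid // eq_sym.
have tblocks a : a \in A ++ B ++ C ++ D -> [/\ t a = a & t (bar a) = bar a].
  rewrite mem_count_mem => aw.
  have ax : a <> x by move=> E; subst a; move: (uniq_count_le1 u x) aw; count_lia.
  have ax' : a <> bar x by move=> E; subst a; move: (uniq_count_le1 u (bar x)) aw; count_lia.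
  have ay : a <> y by move=> E; subst a; move: (uniq_count_le1 u y) aw; count_lia.
  have ay' : a <> bar y by move=> E; subst a; move: (uniq_count_le1 u (bar y)) aw; count_lia.
  by split; apply: tid; apply/eqP => // /(inv_inj barK).
have tmap S : {subset S <= A ++ B ++ C ++ D} -> map t S = S.
  by move=> sS; rewrite -[RHS]map_id; apply/eq_in_map=> a /sS/tblocks[].
have -> : x :: C ++ bar x :: B ++ y :: A ++ bar y :: D =
  map t (x :: C ++ bar y :: B ++ y :: A ++ bar x :: D).
  rewrite /= !(map_cat, map_cons) tx ty tx' ty' /= !tmap //;
    by move=> z zz; rewrite !mem_cat zz ?orbT.
apply: (homo_cycle (e := frel (m \o (t \o bar \o t)))).
  by move=> a c /= /eqP <-.
apply: fcycle_swap_blocks fm => //=; rewrite ?tx ?ty ?tx' ?ty' ?barK ?tx ?ty //.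
by move=> a /tblocks[ta ta'] /=; rewrite ta ta'.
Qed.

Lemma good_move x A B y C D :
  good (x :: A ++ bar x :: B ++ y :: C ++ bar y :: D) ->
  good (x :: C ++ bar x :: B ++ y :: A ++ bar y :: D).
Proof.
case=> u c [m fm qm]; have pw := perm_move x A (bar x) B y C (bar y) D.
split; first by rewrite -(perm_uniq pw).
  by move=> z; rewrite -!(perm_mem pw); apply: c.
pose t := transpose (bar x) (bar y); have tK : involutive t := transposeK _ _.
exists (t \o m \o t); first exact: fcycle_move.
move=> z; rewrite -(perm_mem pw) => zw.
have /qm[q4 q2] : t z \in x :: A ++ bar x :: B ++ y :: C ++ bar y :: D.
  by rewrite /t /transpose; do 2?case: ifP => _ //; rewrite !(mem_cat, inE) eqxx ?orbT.
by rewrite /= !tK q4 tK (can2_eq tK tK).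
Qed.

Lemma reach_good n w w' : reach n w w' -> good w -> good w'.
Proof.
elim=> {n w w'} [//|n U V w _ IH|n x A B y C D w _ IH] gw; apply: IH.
  exact: good_rot.
exact: good_move.
Qed.

Lemma reach_perm n w w' : reach n w w' -> perm_eq w w'.
Proof.
elim=> {n w w'} [//|n U V w _|n x A B y C D w _]; apply: perm_trans.
  by rewrite perm_catC.
exact: perm_move.
Qed.

Definition reaches n (Q : seq T -> Prop) w := exists2 w', reach n w w' & Q w'.

Lemma reaches_here n (Q : seq T -> Prop) w : Q w -> reaches n Q w.
Proof. by move=> Qw; exists w => //; apply: Reach0. Qed.

Lemma reaches_rot n Q U V : reaches n Q (V ++ U) -> reaches n Q (U ++ V).
Proof. by case=> w' r Qw; exists w' => //; apply: ReachRot. Qed.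

Lemma reaches_move n Q w x A B y C D :
  w = x :: A ++ bar x :: B ++ y :: C ++ bar y :: D ->
  reaches n Q (x :: C ++ bar x :: B ++ y :: A ++ bar y :: D) -> reaches n.+1 Q w.
Proof. by move=> -> [w' r Qw]; exists w' => //; apply: ReachMove. Qed.

Lemma reaches_leq n m Q w : n <= m -> reaches n Q w -> reaches m Q w.
Proof. by move=> le [w' r Qw]; exists w' => //; apply: reach_leq r. Qed.

Lemma reaches_bind n m (P Q : seq T -> Prop) w : good w ->
  reaches n P w -> (forall w', good w' -> size w' = size w -> P w' -> reaches m Q w') ->
  reaches (n + m) Q w.
Proof.
move=> gw [w1 r1 Pw1] PQ; have [w2 r2 Qw2] := PQ w1 (reach_good r1 gw) (esym (perm_size (reach_perm r1))) Pw1.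
by exists w2 => //; apply: reach_trans r2.
Qed.

Ltac word_norm := repeat (progress (rewrite /= -?catA ?cat_rcons ?cats0 -?cats1 ?barK)).

Ltac rotate_once :=
  lazymatch goal with
  | |- reaches ?n ?Q (?a :: ?r) => apply: (@reaches_rot n Q [:: a] r)
  | |- reaches ?n ?Q (?A ++ ?r) => apply: (@reaches_rot n Q A r)
  end; word_norm.

Ltac rotate_to x :=
  word_norm;
  lazymatch goal with
  | |- reaches _ _ (x :: _) => idtac
  | |- reaches _ _ (x ++ _) => idtac
  | _ => rotate_once; rotate_to x
  end.

Ltac split_word x w acc :=
  lazymatch w with
  | x :: ?r => constr:((acc, r))
  | ?a :: ?r => split_word x r constr:(acc ++ [:: a])
  | ?A ++ ?r => split_word x r constr:(acc ++ A)
  | ?A => split_word x constr:(A ++ [::]) acc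
  end.

Ltac bar_of bar x :=
  lazymatch x with bar ?d => d | _ => constr:(bar x) end.

(* Rotates the word to the form [x A x' B y C y' D] and exchanges [A] with [C]. *)
Ltac exchange x y :=
  rotate_to x;
  lazymatch goal with
  | |- reaches _ _ (_ :: ?w) =>
    let x' := bar_of bar x in
    let y' := bar_of bar y in
    let p := split_word x' w (@nil T) in
    lazymatch p with (?A, ?w1) =>
    let p := split_word y w1 (@nil T) in
    lazymatch p with (?B, ?w2) =>
    let p := split_word y' w2 (@nil T) in
    lazymatch p with (?C, ?D) =>
      apply: (@reaches_move _ _ _ x A B y C D);
      [ by word_norm | word_norm ]
    end end end
  end.

(** * Creating a loop *)

(** Induction on the length of the gap: an edge with both sides in [A] has a strictly shorter
    gap. *)
Lemma innermost_chord w : {in w, forall x, bar x \in w} -> w != [::] ->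
  exists U x A V, w = U ++ x :: A ++ bar x :: V /\ {in A, forall z, bar z \notin A}.
Proof.
move=> c w0.
have [U [x [A [V wE]]]] : exists U x A V, w = U ++ x :: A ++ bar x :: V.
  case: w c w0 => // x w c _; have := c x (mem_head _ _).
  rewrite inE (negPf (barN x)) /= => /splitPr[A V].
  by exists [::], x, A, V.
have [n] := ubnP (size A); elim: n U x A V wE => // n IH U x A V wE le_n.
case: (boolP (has (fun z => bar z \in A) A)) => [/hasP[z zA z'A]|/hasPn nA]; last first.
  by exists U, x, A, V.
case/splitPr: zA wE le_n z'A => A1 A2 wE le_n.
rewrite mem_cat inE (negPf (barN z)) /= => /orP[] /splitPr E.
- case: E wE le_n => A3 A4 wE; rewrite !size_cat /= => le_n.
  apply: (IH (U ++ x :: A3) (bar z) A4 (A2 ++ bar x :: V)); last by lia.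
  by rewrite wE barK; word_eq.
- case: E wE le_n => A3 A4 wE; rewrite !size_cat /= !size_cat /= => le_n.
  apply: (IH (U ++ x :: A1) z A3 (A4 ++ bar x :: V)); last by lia.
  by rewrite wE; word_eq.
Qed.

Definition has_loop w := exists p b R, w = p :: b :: bar p :: R.

Lemma reaches_loop n p b p' R : p' = bar p -> reaches n has_loop (p :: b :: p' :: R).
Proof. by move->; apply: reaches_here; exists p, b, R. Qed.

(* The corners [x a | c x' | d' c' | a' d] of a vertex, met by the face in the
   order opposite to that of a planar vertex. *)
Definition antiplanar x a A c B1 d B2 B3 :=
  x :: a :: A ++ c :: bar x :: B1 ++ bar d :: bar c :: B2 ++ bar a :: d :: B3.

(** Here and in the next two lemmas, the edge [z] serves as an auxiliary: the two moves carry the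
    block from [bar c] to [bar a] to the place just after [bar x], which leaves the loop [c],
    [bar x], [bar c]. *)
Lemma antiplanar_loop_same_gap x a P z Q R c B1 d B2 B3 :
  reaches 2 has_loop (antiplanar x a (P ++ z :: Q ++ bar z :: R) c B1 d B2 B3).
Proof.
rewrite /antiplanar; exchange z (bar x); exchange (bar d) (bar x).
rotate_to c; by apply: reaches_loop; rewrite ?barK.
Qed.

Lemma antiplanar_loop_next_gap x a P z Q c R S d B2 B3 :
  reaches 2 has_loop (antiplanar x a (P ++ z :: Q) c (R ++ bar z :: S) d B2 B3).
Proof.
rewrite /antiplanar; exchange z (bar d); exchange (bar x) z.
rotate_to c; by apply: reaches_loop; rewrite ?barK.
Qed.

Lemma antiplanar_loop_previous_gap x a P z Q c B1 d B2 R S :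
  reaches 2 has_loop (antiplanar x a (P ++ z :: Q) c B1 d B2 (R ++ bar z :: S)).
Proof.
rewrite /antiplanar; exchange (bar d) (bar z); exchange (bar z) (bar x).
rotate_to c; by apply: reaches_loop; rewrite ?barK.
Qed.

Lemma antiplanar_loop x a A c B1 d B2 B3 z (w := antiplanar x a A c B1 d B2 B3) :
  uniq w -> z \in A -> bar z \in w -> bar z \notin B2 -> reaches 2 has_loop w.
Proof.
rewrite /w {w} => u zA z'w z'B2.
have : [|| bar z \in A, bar z \in B1 | bar z \in B3].
  have nz : bar z \notin [:: x; a; c; bar x; bar d; bar c; bar a; d].
    case/splitPr: zA u {z'w} => P Q u; rewrite /antiplanar in u.
    by apply/negP; rewrite !inE; not_partner u z.
  move: z'w nz; rewrite /antiplanar !(inE, mem_cat) (negPf z'B2).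
  by do ?[case: (bar z == _) => //=]; rewrite ?orbF.
case/splitPr: zA {u z'w z'B2} => P Q; case/or3P=> z'.
- move: z'; rewrite mem_cat inE (negPf (barN z)) /= => /orP[] /splitPr[P1 P2].
    by have := antiplanar_loop_same_gap x a P1 (bar z) P2 Q c B1 d B2 B3; rewrite barK -catA.
  exact: antiplanar_loop_same_gap.
- by case/splitPr: z' => R S; apply: antiplanar_loop_next_gap.
- by case/splitPr: z' => R S; apply: antiplanar_loop_previous_gap.
Qed.

Lemma vertex_injective (m : T -> T) w :
  {in w, forall x, m (m (m (m x))) = x /\ m (m x) != x} -> {in w &, injective m}.
Proof. by move=> qm x y /qm[mx _] /qm[my _] E; rewrite -mx E my. Qed.

(** Either a letter of one of the gaps [A], [B2] has its partner outside the other gap, and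
    [antiplanar_loop] applies, or the two gaps are matched with each other and a neighbouring vertex
    is used. *)
Lemma antiplanar_good_loop x a A c B1 d B2 B3 (w := antiplanar x a A c B1 d B2 B3) :
  good w -> reaches 2 has_loop w.
Proof.
move=> gw; case: (gw) => u cl [m fm qm].
have [/hasP[z zA z'B2]|/hasPn AB2] := boolP (has (fun z => bar z \notin B2) A).
  apply: (antiplanar_loop u zA _ z'B2); apply: cl.
  by rewrite /w /antiplanar !(inE, mem_cat) zA !orbT.
have [/hasP[z zB2 z'A]|/hasPn B2A] := boolP (has (fun z => bar z \notin A) B2).
  (* The antiplanar pattern is invariant under a half-turn that exchanges the roles of [A] and
     [B2]. *)
  pose w' := antiplanar (bar d) (bar c) B2 (bar a) B3 (bar x) A B1.
  have wE : w = (x :: a :: A ++ c :: bar x :: B1) ++ (bar d :: bar c :: B2 ++ bar a :: d :: B3).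
    by rewrite /w /antiplanar; word_eq.
  have w'E : w' = (bar d :: bar c :: B2 ++ bar a :: d :: B3) ++ (x :: a :: A ++ c :: bar x :: B1).
    by rewrite /w' /antiplanar; word_norm.
  rewrite wE; apply: reaches_rot; rewrite -w'E.
  have ww' z0 : (z0 \in w') = (z0 \in w) by rewrite wE w'E !mem_cat orbC.
  have u' : uniq w' by rewrite w'E uniq_catC -wE.
  apply: (antiplanar_loop u' zB2 _ z'A).
  by rewrite -/w' ww'; apply: cl; rewrite /w /antiplanar !(inE, mem_cat) zB2 !orbT.
have memw z : z \in A ++ B2 -> z \in w.
  by rewrite mem_cat /w /antiplanar !(inE, mem_cat) => /orP[] ->; rewrite !orbT.
have cw : c \in w by rewrite /w /antiplanar !(inE, mem_cat) eqxx !orbT.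
move: memw cw u cl fm qm {gw}; rewrite /w /antiplanar {w}.
(* If [B2] is empty, so is [A]; then [m] exchanges [c] and [bar a], which is impossible at a vertex
   of degree 4. *)
case: B2 AB2 B2A => [|r B2'] AB2 B2A memw cw u cl fm qm.
  case: A AB2 {B2A} memw cw u cl fm qm => [|e A] AB2 memw cw u cl fm qm; last first.
    by have := AB2 e (mem_head _ _).
  have mc : m c = bar a.
    rewrite -[c]barK; apply: (fcycle_next (A := x :: a :: c :: bar x :: B1 ++ [:: bar d]) (B := d :: B3) fm).
    by word_norm.
  have ma : m (bar a) = c.
    by apply: (fcycle_next (A := [:: x]) (B := bar x :: B1 ++ bar d :: bar c :: bar a :: d :: B3) fm); word_norm.
  by have [_] := qm c cw; rewrite mc ma eqxx.
(* Now the edges with one end in [A] have the other one in [B2].  With [r] the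
   first letter of [B2], [s] the letter after [r'] and [y] the last letter of
   [A], the vertex [c, r, s, y'] is not antiplanar, and one move suffices. *)
have /negPn r'A := B2A r (mem_head _ _).
case/splitPr: r'A AB2 memw cw u cl fm qm {B2A} => P A' AB2 memw cw u cl fm qm.
have mc : m c = r.
  rewrite -[c]barK; apply: (fcycle_next (A := x :: a :: (P ++ bar r :: A') ++ c :: bar x :: B1 ++ [:: bar d]) (B := B2' ++ bar a :: d :: B3) fm).
  by word_norm.
case: A' AB2 memw cw u cl fm qm => [|s A'] AB2 memw cw u cl fm qm.
  have mr : m r = c.
    rewrite -[r]barK; apply: (fcycle_next (A := x :: a :: P) (B := bar x :: B1 ++ bar d :: bar c :: (bar (bar r) :: B2') ++ bar a :: d :: B3) fm).
    by word_norm.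
  by have [_] := qm c cw; rewrite mc mr eqxx.
have mr : m r = s.
  rewrite -[r]barK; apply: (fcycle_next (A := x :: a :: P) (B := A' ++ c :: bar x :: B1 ++ bar d :: bar c :: (bar (bar r) :: B2') ++ bar a :: d :: B3) fm).
  by word_norm.
have [Q [y sA']] : exists Q y, s :: A' = rcons Q y by exists (belast s A'), (last s A'); exact: lastI.
have my' : m (bar y) = c.
  apply: (fcycle_next (A := x :: a :: P ++ bar r :: Q) (x := y) (B := bar x :: B1 ++ bar d :: bar c :: (r :: B2') ++ bar a :: d :: B3) fm).
  by rewrite sA'; word_norm.
have yA : y \in s :: A' by rewrite sA' mem_rcons mem_head.
have y'w : bar y \in x :: a :: (P ++ bar r :: s :: A') ++ c :: bar x :: B1 ++ bar d :: bar c :: (r :: B2') ++ bar a :: d :: B3.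
  by apply: cl; move: yA; rewrite !(inE, mem_cat) => /orP[] ->; rewrite !orbT.
have ms : m s = bar y by have [] := qm _ y'w; rewrite my' mc mr.
have s'B : bar s \in r :: B2'.
  by have := AB2 s; rewrite negbK; apply; rewrite mem_cat !inE eqxx !orbT.
have s'r : bar s <> r by move=> E; rewrite -E barK in u; dup u s.
move: s'B; rewrite inE => /orP[/eqP //|] s'B.
have cy : 0 < count_mem y (s :: A') by rewrite -mem_count_mem.
have fs : (m \o bar) (bar s) = bar y by rewrite -ms -{2}[s]barK.
case/splitPr: s'B {y'w memw AB2} cl fm u qm cw => R [|h S] cl fm u qm cw.
  have : (m \o bar) (bar s) = bar a.
    apply: (fcycle_next (A := x :: a :: (P ++ bar r :: s :: A') ++ c :: bar x :: B1 ++ bar d :: bar c :: r :: R) (B := d :: B3) fm).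
    by word_norm.
  rewrite fs => /(inv_inj barK) ya; subst a.
  by exfalso; move: cy (uniq_count_le1 u y); count_lia.
have : (m \o bar) (bar s) = h.
  apply: (fcycle_next (A := x :: a :: (P ++ bar r :: s :: A') ++ c :: bar x :: B1 ++ bar d :: bar c :: r :: R) (B := S ++ bar a :: d :: B3) fm).
  by word_norm.
rewrite fs => yh; subst h.
have [Q' A'E] : exists Q', A' = rcons Q' y.
  case: Q sA' => [[sy _]|_ Q [_ ->]]; last by exists Q.
  by rewrite sy in u; dup u (bar y).
(* As [y] precedes [c] and [bar y] follows [bar s], the exchange produces [y], [c], [bar y]. *)
rewrite A'E; exchange c (bar s).
rotate_to y; by apply: reaches_loop; rewrite ?barK.
Qed.

(** Let [x] have an innermost gap, with first letter [a] and last letter [c]. If these differ,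
    [bar a] and [bar c] lie outside the gap, and [bar c], [bar x], [a] are consecutive at one
    vertex. If [bar c] comes before [bar a], this vertex is antiplanar; otherwise at most one move
    is needed. *)
Lemma good_reaches_loop w : good w -> w != [::] -> reaches 2 has_loop w.
Proof.
move=> gw w0; case: (gw) => u0 cl0 _.
have [U [x [A0 [V [wE nA]]]]] := innermost_chord cl0 w0.
have : good (x :: A0 ++ bar x :: V ++ U).
  by have := gw; rewrite {1}wE => /good_rot; word_norm.
suff H : good (x :: A0 ++ bar x :: V ++ U) -> reaches 2 has_loop (x :: A0 ++ bar x :: V ++ U).
  by move=> /H r; rewrite wE; apply: reaches_rot; word_norm.
move: (V ++ U) => B {w gw w0 u0 cl0 U V wE} gw.
case: (gw) => u cl [m fm qm].
case: A0 nA gw u cl fm qm => [|a A0] nA gw u cl fm qm.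
  have mx : m (bar x) = bar x by apply: (fcycle_next (A := [::]) (x := x) (B := B) fm).
  by have [] := qm (bar x); rewrite ?mx ?eqxx // !inE eqxx orbT.
have mx' : m (bar x) = a.
  by apply: (fcycle_next (A := [::]) (x := x) (B := A0 ++ bar x :: B) fm).
case/lastP: A0 nA gw u cl fm qm => [|A c] nA gw u cl fm qm.
  by apply: reaches_loop; rewrite ?barK.
rewrite cat_cons cat_rcons in gw u cl fm qm *.
have mc' : m (bar c) = bar x.
  by apply: (fcycle_next (A := x :: a :: A) (x := c) (B := B) fm); word_norm.
have [a'B c'B] : bar a \in B /\ bar c \in B.
  have na z : z \in [:: a; c] -> bar z \notin [:: x; bar x].
    by rewrite !inE => /orP[] /eqP->; apply/negP;
      [not_partner u a | not_partner u c].
  have mem z : z \in [:: a; c] -> bar z \in B.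
    move=> zac; move: (cl z) (nA z) (na z zac).
    have -> : z \in a :: rcons A c by move: zac; rewrite !inE mem_rcons inE => /orP[] ->; rewrite ?orbT.
    have -> : z \in x :: a :: A ++ c :: bar x :: B.
      by move: zac; rewrite !(inE, mem_cat) => /orP[] ->; rewrite ?orbT.
    move=> /(_ isT) + /(_ isT) + zx; rewrite !(inE, mem_cat, mem_rcons) !negb_or.
    move: zx; rewrite !inE negb_or => /andP[/negPf-> /negPf->].
    by move=> + /and3P[/negPf n1 /negPf n2 /negPf n3]; rewrite n1 n2 n3.
  by split; apply: mem; rewrite !inE eqxx ?orbT.
(* When [bar a] ends the word, [bar a], [x], [a] is already a loop. *)
case/splitPr: a'B gw u cl fm qm c'B => B' [|d B3] gw u cl fm qm c'B.
  by rotate_to (bar a); apply: reaches_loop; rewrite ?barK.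
have ma : m a = d.
  rewrite -[a]barK; apply: (fcycle_next (A := x :: a :: A ++ c :: bar x :: B') (B := B3) fm).
  by word_norm.
have md : m d = bar c.
  have [|+ _] := qm (bar c); first by move: c'B; rewrite !(inE, mem_cat) => ->; rewrite !orbT.
  by rewrite mc' mx' ma.
have inj := vertex_injective qm.
(* The fourth corner of the vertex: the letter preceding [bar c] can only be [bar d]. *)
have pred_c' e : (m \o bar) e = bar c ->
    e \in x :: a :: A ++ c :: bar x :: B' ++ bar a :: d :: B3 -> e = bar d.
  rewrite -md => E ew; apply: (can_inj barK); rewrite barK.
  by apply: inj E; [apply: cl | rewrite !(inE, mem_cat) eqxx !orbT].
move: c'B; rewrite mem_cat !inE => /or4P[c'B|/eqP E|/eqP E|c'B].
- case/splitPr: c'B gw u cl fm qm pred_c' {inj} => B1 B2; case/lastP: B1 => [|B1 e] gw u cl fm qm pred_c'.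
    have /pred_c' : (m \o bar) (bar x) = bar c.
      by apply: (fcycle_next (A := x :: a :: A ++ [:: c]) (B := B2 ++ bar a :: d :: B3) fm); word_norm.
    rewrite !(inE, mem_cat) eqxx !orbT => /(_ isT)/(inv_inj barK) E.
    by rewrite E in u; dup u d.
  have /pred_c' : (m \o bar) e = bar c.
    by apply: (fcycle_next (A := x :: a :: A ++ c :: bar x :: B1) (B := B2 ++ bar a :: d :: B3) fm); word_norm.
  rewrite !(inE, mem_cat, mem_rcons) eqxx !orbT => /(_ isT) E.
  by move: gw; rewrite E; word_norm; apply: antiplanar_good_loop.
- by move/(inv_inj barK): E => E; rewrite E in u; dup u a.
- have [|_] := qm d; first by rewrite !(inE, mem_cat) eqxx !orbT.
  by rewrite md E md E eqxx.
- case/splitPr: c'B gw u cl fm qm pred_c' {inj} => B2 B4; case/lastP: B2 => [|B2 e] gw u cl fm qm pred_c'.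
    have /pred_c' : (m \o bar) d = bar c.
      by apply: (fcycle_next (A := x :: a :: A ++ c :: bar x :: B' ++ [:: bar a]) (B := B4) fm); word_norm.
    rewrite !(inE, mem_cat) eqxx !orbT => /(_ isT) E.
    by have := barN d; rewrite -E eqxx.
  have /pred_c' : (m \o bar) e = bar c.
    by apply: (fcycle_next (A := x :: a :: A ++ c :: bar x :: B' ++ bar a :: d :: B2) (B := B4) fm); word_norm.
  rewrite !(inE, mem_cat, mem_rcons) eqxx !orbT => /(_ isT) ->.
  (* The move brings the gap of [x], which begins with [a], just after [d], whence the loop [bar a],
     [d], [a]. *)
  by word_norm; exchange x d; rotate_to (bar a); apply: reaches_loop; rewrite ?barK.
Qed.

(** * Creating a handle *)

(** The vertex of the loop is [bar b], [bar p], [b], [m b]. Its last two corners say that [bar b]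
    stands between [q] and [bar q] with [bar q = m b]. The bound on [R] excludes the torus word
    [p b (bar p) (bar b)]. *)
Lemma loop_corners p b R : good (p :: b :: bar p :: R) -> 1 < size R ->
  exists U q V, R = U ++ q :: bar b :: bar q :: V.
Proof.
move=> [u cl [m fm qm]] sR; have inj := vertex_injective qm.
have mb' : m (bar b) = bar p.
  by apply: (fcycle_next (A := [:: p]) (x := b) (B := R) fm).
have mp' : m (bar p) = b.
  by apply: (fcycle_next (A := [::]) (x := p) (B := bar p :: R) fm).
have b'R : bar b \in R.
  have := cl b; rewrite !inE eqxx orbT => /(_ isT).
  have : bar b \notin [:: p; b; bar p].
    apply/negP; rewrite !inE (negPf (barN b)); not_partner u b.
  by rewrite !inE !negb_or => /and3P[/negPf-> /negPf-> /negPf->].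
have bw : b \in p :: b :: bar p :: R by rewrite !inE eqxx orbT.
have b'w : bar b \in p :: b :: bar p :: R by rewrite !inE b'R !orbT.
have mmb : m (m b) = bar b by have [+ _] := qm _ b'w; rewrite mb' mp'.
have mbw : m b \in p :: b :: bar p :: R by apply: (good_vertex_closed cl fm).
have pred_b' e : (m \o bar) e = bar b -> e \in p :: b :: bar p :: R -> m b = bar e.
  by move=> E ew; apply: inj => //; [apply: cl | rewrite mmb -E].
case/splitPr: b'R u cl fm qm sR {mbw inj bw b'w} pred_b' => R1 R2 u cl fm qm sR pred_b'.
have mb R2' h : R2 = h :: R2' -> m b = h.
  move=> E; rewrite -[b]barK; apply: (fcycle_next (A := p :: b :: bar p :: R1) (B := R2') fm).
  by rewrite E; word_norm.
have mb0 : R2 = [::] -> m b = p.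
  by move=> E; rewrite -[b]barK; apply: (fcycle_last (A := b :: bar p :: R1) fm); rewrite E.
case/lastP: R1 u cl fm qm sR pred_b' mb mb0 => [|U q] u cl fm qm sR pred_b' mb mb0.
  have /pred_b' : (m \o bar) (bar p) = bar b.
    by apply: (fcycle_next (A := [:: p; b]) (B := R2) fm).
  rewrite !inE eqxx !orbT barK => /(_ isT) mbp.
  case: R2 u cl fm qm sR mb {mb0 pred_b'} => // h R2 u cl fm qm sR mb.
  by have := mb _ _ erefl; rewrite mbp => E; rewrite -E in u; dup u p.
have /pred_b' : (m \o bar) q = bar b.
  by apply: (fcycle_next (A := p :: b :: bar p :: U) (B := R2) fm); word_norm.
rewrite !(inE, mem_cat, mem_rcons) eqxx !orbT => /(_ isT) mbq.
case: R2 u cl fm qm sR mb mb0 {pred_b'} => [|h V] u cl fm qm sR mb mb0.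
  by have := mb0 erefl; rewrite mbq => E; rewrite -E barK in u; dup u q.
have := mb _ _ erefl; rewrite mbq => E.
by exists U, q, V; rewrite E; word_norm.
Qed.

Definition has_torus w := exists p b q V,
  w = [:: p; b; bar p; q; bar b; bar q] ++ V.

Lemma reaches_torus n p b p' q b' q' V : p' = bar p -> b' = bar b -> q' = bar q ->
  reaches n has_torus (p :: b :: p' :: q :: b' :: q' :: V).
Proof. by move=> -> -> ->; apply: reaches_here; exists p, b, q, V. Qed.

(** Exchanging the gaps of [p] and [bar z] puts [b] between [bar z] and [z], next to [q]. *)
Lemma torus_self_chord p b U1 z U2 q V :
  reaches 1 has_torus
    (p :: b :: bar p :: U1 ++ bar z :: U2 ++ z :: q :: bar b :: bar q :: V).
Proof.
exchange p (bar z); rotate_to (bar z).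
by apply: reaches_torus; rewrite ?barK.
Qed.

(** The first move carries the loop into the gap of [c], so that [bar z] comes between the loop and
    [z], as in [torus_self_chord]. *)
Lemma torus_chord_before p b U z q c V1 V2 V3 :
  reaches 2 has_torus
    (p :: b :: bar p :: U ++ z :: q :: bar b :: bar q :: c :: V1 ++ bar c :: V2 ++ bar z :: V3).
Proof.
exchange c (bar z); rotate_to p.
have := torus_self_chord p b (U ++ bar c :: V2) z V1 q (c :: V3).
by word_norm.
Qed.

(** The first move transfers the loop from [p] to [bar c], which brings [bar z] between the loop and
    [z]. *)
Lemma torus_chord_across p b U1 c U2 z q V1 V2 :
  reaches 2 has_torus
    (p :: b :: bar p :: U1 ++ bar c :: U2 ++ z :: q :: bar b :: bar q :: c :: V1 ++ bar z :: V2).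
Proof.
exchange p (bar c); rotate_to (bar c).
have := torus_self_chord (bar c) b V1 z (V2 ++ p :: U2) q (bar p :: U1).
by word_norm.
Qed.

(** One move gives the configuration of [torus_chord_across] with [p] and [z] interchanged. *)
Lemma torus_chord_after p b U z q c V1 V2 V3 :
  reaches 3 has_torus
    (p :: b :: bar p :: U ++ z :: q :: bar b :: bar q :: c :: V1 ++ bar z :: V2 ++ bar c :: V3).
Proof.
exchange p z; rotate_to z.
have := torus_chord_across z b V2 c V3 p q V1 U.
by word_norm.
Qed.

(** Let [z] be the letter before [q] and [c] the letter after [bar q]. The positions of [bar z] and
    [bar c] select one of the four configurations above. *)
Lemma good_reaches_torus w : good w -> has_loop w -> 4 < size w -> reaches 3 has_torus w.
Proof.
move=> gw [p [b [R wE]]]; rewrite {}wE in gw *; rewrite /= => sR.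
have [|U [q [V RE]]] := loop_corners gw; first by lia.
rewrite {}RE in gw *; clear R sR.
case/lastP: U gw => [|U z] gw; first by apply: reaches_torus.
case: (gw) => u cl [m fm qm].
have : bar z \in U ++ V.
  have := cl z; rewrite !(inE, mem_cat, mem_rcons) eqxx !orbT => /(_ isT).
  have : bar z \notin [:: p; b; bar p; z; q; bar b; bar q].
    apply/negP; rewrite !inE (negPf (barN z)); not_partner u z.
  rewrite !inE !negb_or => /and5P[/negPf-> /negPf-> /negPf-> /negPf-> /and3P[/negPf-> /negPf-> /negPf->]].
  by rewrite /= ?orbF.
rewrite mem_cat => /orP[] /splitPr E.
  case: E gw u cl fm qm => U1 U2 *; apply: (reaches_leq (n := 1)) => //.
  by have := torus_self_chord p b U1 z U2 q V; word_norm.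
(* If [bar z] came right after [bar q], [m] would exchange [q] and [bar z]. *)
case: E gw u cl fm qm => V1 V2; case: V1 => [|c V1] gw u cl fm qm.
  have mq : m q = bar z.
    rewrite -[q]barK; apply: (fcycle_next (A := p :: b :: bar p :: U ++ z :: q :: [:: bar b]) (B := V2) fm).
    by word_norm.
  have mz : m (bar z) = q.
    by apply: (fcycle_next (A := p :: b :: bar p :: U) (x := z) (B := bar b :: bar q :: bar z :: V2) fm); word_norm.
  have [|_] := qm q; first by rewrite !(inE, mem_cat) eqxx !orbT.
  by rewrite mq mz eqxx.
have : [|| bar c \in U, bar c \in V1 | bar c \in V2].
  have := cl c; rewrite !(inE, mem_cat, mem_rcons) eqxx !orbT => /(_ isT).
  have : bar c \notin [:: p; b; bar p; z; q; bar b; bar q; c; bar z].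
    apply/negP; rewrite !inE (negPf (barN c)); not_partner u c.
  rewrite !inE !negb_or => /and5P[/negPf-> /negPf-> /negPf-> /negPf-> /and5P[/negPf-> /negPf-> /negPf-> /negPf-> /negPf->]].
  by rewrite /= ?orbF.
case/or3P=> /splitPr E; case: E {gw u cl fm qm} => P Q.
- apply: (reaches_leq (n := 2)) => //.
  by have := torus_chord_across p b P c Q z q V1 V2; word_norm.
- apply: (reaches_leq (n := 2)) => //.
  by have := torus_chord_before p b U z q c P Q V2; word_norm.
- by have := torus_chord_after p b U z q c V1 P Q; word_norm.
Qed.

(** * Detaching, attaching and sliding handles *)

Lemma path_relabel (f f0 r : T -> T) x s e :
  {in x :: s, forall z, f0 z = r (f z)} -> {in s, forall z, r z = z} ->
  path (frel f) x (rcons s e) -> path (frel f0) x (rcons s (r e)).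
Proof.
elim: s x => [|a s IH] x /= f0E rE; first by move=> /andP[/eqP <- _]; rewrite f0E ?mem_head ?eqxx.
move=> /andP[/eqP fx ps]; rewrite f0E ?mem_head // fx rE ?mem_head // eqxx /=.
by apply: IH ps => z zs; [apply: f0E | apply: rE]; rewrite inE zs orbT.
Qed.

(** The vertex containing [p] and [q] continues with the first letter [v] of [V] and with [bar y],
    where [y] is the last one. Its corner between them forces [bar y] to follow [bar v]. *)
Lemma torus_corners p b q V :
  good ([:: p; b; bar p; q; bar b; bar q] ++ V) -> V != [::] ->
  exists v P y Q, V = v :: P ++ bar v :: bar y :: Q ++ [:: y].
Proof.
case: V => // v V [u cl [m fm qm]] _.
have mp : m p = q.
  by rewrite -[p]barK; apply: (fcycle_next (A := [:: p; b]) (B := bar b :: bar q :: v :: V) fm).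
have mq : m q = v.
  by rewrite -[q]barK; apply: (fcycle_next (A := [:: p; b; bar p; q; bar b]) (B := V) fm).
have v'V : bar v \in V.
  have := cl v; rewrite !(inE, mem_cat) eqxx !orbT => /(_ isT).
  have : bar v \notin [:: p; b; bar p; q; bar b; bar q; v].
    by apply/negP; rewrite !inE (negPf (barN v)); not_partner u v.
  rewrite !inE !negb_or => /and5P[/negPf-> /negPf-> /negPf-> /negPf-> /and3P[/negPf-> /negPf-> /negPf->]].
  by [].
case/splitPr: v'V u cl fm qm => P R u cl fm qm.
case/lastP: R u cl fm qm => [|R y] u cl fm qm.
  have mv : m v = p.
    rewrite -[v]barK; apply: (fcycle_last (A := [:: b; bar p; q; bar b; bar q; v] ++ P) fm).
    by word_norm.
  have [+ _] := qm p (mem_head _ _); rewrite mp mq mv mp => E.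
  by rewrite E in u; dup u p.
have my' : m (bar y) = p.
  apply: (fcycle_last (A := [:: b; bar p; q; bar b; bar q; v] ++ P ++ bar v :: R) (x := y) fm).
  by word_norm.
have mv : m v = bar y.
  have [|+ _] := qm (bar y); first by apply: cl; rewrite !(inE, mem_cat, mem_rcons) eqxx !orbT.
  by rewrite my' mp mq.
have mvE h R' : rcons R y = h :: R' -> h = bar y.
  move=> E; rewrite -mv -{1}[v]barK; symmetry.
  apply: (fcycle_next (A := [:: p; b; bar p; q; bar b; bar q; v] ++ P) (B := R') fm).
  by rewrite E; word_norm.
case: R {u cl fm qm} mvE => [|h Q] mvE.
  by have := mvE _ _ erefl => /eqP; rewrite eq_sym (negPf (barN y)).
by exists v, P, y, Q; rewrite (mvE _ _ erefl); word_norm.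
Qed.

(* The vertex [v, y', p, q] disappears and the edges [y] and [v] are merged. *)
Lemma good_detach p b q v P y Q :
  good (v :: P ++ bar v :: bar y :: Q ++ y :: [:: p; b; bar p; q; bar b; bar q]) ->
  good (v :: P ++ bar v :: Q).
Proof.
set T0 := [:: p; b; bar p; q; bar b; bar q].
move=> [u cl [m fm qm]]; have inj := vertex_injective qm.
have W z : z \in v :: P ++ bar v :: Q -> z \in v :: P ++ bar v :: bar y :: Q ++ y :: T0.
  by rewrite !(inE, mem_cat) => /or4P[] ->; rewrite ?orbT.
have fresh z : z \in v :: P ++ bar v :: Q -> z \notin y :: bar y :: T0.
  rewrite mem_count_mem => zw; apply/negP; rewrite mem_count_mem.
  by move: zw (uniq_count_le1 u z); count_lia.
have u0 : uniq (v :: P ++ bar v :: Q).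
  apply: subseq_uniq u; rewrite /= eqxx; apply: cat_subseq => //=; rewrite eqxx.
  apply: (subseq_trans _ (subseq_cons _ _)); exact: prefix_subseq.
have cl0 : {in v :: P ++ bar v :: Q, forall z, bar z \in v :: P ++ bar v :: Q}.
  move=> z zw; have := cl z (W z zw).
  have : bar z \notin y :: bar y :: T0.
    apply: contra (fresh z zw); rewrite -{2}[z]barK !inE.
    by do ?case/orP; move=> /eqP->; rewrite ?barK eqxx ?orbT.
  rewrite !(inE, mem_cat) !negb_or => /andP[/negPf-> /andP[/negPf-> /and5P[/negPf-> /negPf-> /negPf-> /negPf-> /andP[/negPf-> /negPf->]]]].
  by rewrite /= ?orbF.
have yW : y \in v :: P ++ bar v :: bar y :: Q ++ y :: T0 by rewrite !(inE, mem_cat) eqxx ?orbT.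
have vW : v \in v :: P ++ bar v :: bar y :: Q ++ y :: T0 by rewrite mem_head.
have mclosed := good_vertex_closed cl fm.
have mv : m v = bar y.
  by rewrite -[v]barK; apply: (fcycle_next (A := v :: P) (B := Q ++ y :: T0) fm); word_norm.
have my' : m (bar y) = p.
  by apply: (fcycle_next (A := v :: P ++ bar v :: bar y :: Q) (x := y) (B := behead T0) fm); word_norm.
have mp : m p = q.
  by rewrite -[p]barK; apply: (fcycle_next (A := v :: P ++ bar v :: bar y :: Q ++ [:: y; p; b]) (B := [:: bar b; bar q]) fm); word_norm.
have mq : m q = v.
  by rewrite -[q]barK; apply: (fcycle_last (A := P ++ bar v :: bar y :: Q ++ [:: y; p; b; bar p; q; bar b]) fm); word_norm.
case: Q => [|h Q] in u cl fm qm inj W fresh u0 cl0 yW vW mclosed *.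
  have my : m y = y.
    by rewrite -{1}[y]barK; apply: (fcycle_next (A := v :: P ++ [:: bar v]) (B := T0) fm); word_norm.
  by have [_] := qm y yW; rewrite !my eqxx.
have my : m y = h.
  by rewrite -{1}[y]barK; apply: (fcycle_next (A := v :: P ++ [:: bar v]) (B := Q ++ y :: T0) fm); word_norm.
(* The half-edge [v] disappears with the vertex, so its name is free for the half-edge [y] at the
   far end of the merged edge. [m0] is [m] transported along this renaming. *)
pose r z := if z == y then v else z.
pose m0 z := if z == v then m y else r (m z).
split=> //; exists m0.
- have rid z : z \in v :: P ++ bar v :: h :: Q -> r z = z.
    by move=> /fresh; rewrite /r inE negb_or => /andP[/negPf->].
  have bv z : z \in v :: P ++ h :: Q -> (bar z == v) = false.
    move=> zw; apply/eqP=> E; move: zw; rewrite -[z]barK E mem_count_mem.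
    by move: (uniq_count_le1 u0 (bar v)); count_lia.
  have /and3P[pP _ pQ] : [&& path (frel (m \o bar)) v (rcons P (bar v)), true
      & path (frel (m \o bar)) h (rcons Q y)].
    move: fm; rewrite -cat_rcons /= rcons_cat cat_path last_rcons /= => /andP[-> /and3P[_ _]].
    by rewrite -cat_rcons rcons_cat cat_path => /andP[->].
  have m0v' : (m0 \o bar) (bar v) = h by rewrite /= barK /m0 eqxx my.
  have -> : v :: P ++ bar v :: h :: Q = v :: rcons P (r (bar v)) ++ h :: Q.
    by rewrite rid ?cat_rcons // !(inE, mem_cat) eqxx !orbT.
  rewrite /= rcons_cat cat_path last_rcons /=.
  rewrite rid ?[X in _ && ((X == _) && _)]m0v' ?eqxx /=; last by rewrite !(inE, mem_cat) eqxx !orbT.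
  have ry : r y = v by rewrite /r eqxx.
  have m0E z : z \in v :: P ++ h :: Q -> (m0 \o bar) z = r ((m \o bar) z).
    by move=> /bv zv; rewrite /= /m0 zv.
  apply/andP; split.
    rewrite -[X in rcons P X]rid ?(mem_cat, inE) ?eqxx ?orbT //.
    apply: path_relabel pP => z zP; [apply: m0E | apply: rid];
      by move: zP; rewrite !(inE, mem_cat); repeat case/orP; move=> ->; rewrite ?orbT.
  rewrite -ry.
  apply: path_relabel pQ => z zQ; [apply: m0E | apply: rid];
    by move: zQ; rewrite !(inE, mem_cat); repeat case/orP; move=> ->; rewrite ?orbT.
- pose W0 := v :: P ++ bar v :: bar y :: (h :: Q) ++ y :: T0.
  (* The letters away from the deleted vertex are stable under [m], and [r] is injective on them
     since [v] is not among them. Hence [m0] inherits the 4-cycles of [m]. *)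
  pose S z := (z \in W0) && (z \notin [:: v; bar y; p; q]).
  have mS z : S z -> S (m z).
    move=> /andP[zW nz]; rewrite /S mclosed //=; apply: contra nz.
    have [vW' y'W pW qW] : [/\ v \in W0, bar y \in W0, p \in W0 & q \in W0].
      by split; rewrite !(inE, mem_cat) eqxx ?orbT.
    rewrite !inE => /or4P[] /eqP E.
    + by rewrite (inj z q zW qW) ?E ?mq // eqxx !orbT.
    + by rewrite (inj z v zW vW') ?E ?mv // eqxx.
    + by rewrite (inj z (bar y) zW y'W) ?E ?my' // eqxx !orbT.
    + by rewrite (inj z p zW pW) ?E ?mp // eqxx !orbT.
  have m0r z : S z -> m0 (r z) = r (m z).
    move=> Sz; case/andP: (Sz) => zW nz; rewrite /r; case: (z =P y) => [->|zy].
      rewrite /m0 eqxx; case: eqP => // E; by have [_] := qm y yW; rewrite !E eqxx.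
    rewrite /m0; case: eqP => // E; by move: nz; rewrite E inE eqxx.
  have rS z z' : S z -> S z' -> r z = r z' -> z = z'.
    move=> /andP[_ nz] /andP[_ nz']; rewrite /r.
    case: eqP => [->|_]; case: eqP => [->|_] // E; [move: nz'|move: nz]; by rewrite E inE eqxx.
  move=> z zw.
  have [z' Sz' <-] : exists2 z', S z' & r z' = z.
    have [->|zv] := eqVneq z v.
      exists y; last by rewrite /r eqxx.
      rewrite /S yW; apply/negP; rewrite !inE => /or4P[] /eqP E.
      + by rewrite E in u; dup u v.
      + by have := barN y; rewrite -E eqxx.
      + by rewrite E in u; dup u p.
      + by rewrite E in u; dup u q.
    exists z; last first.
      by move: (fresh z zw); rewrite /r inE negb_or => /andP[/negPf->].
    rewrite /S W //= inE negb_or zv /=; apply: contra (fresh z zw).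
    by rewrite !inE => /or3P[] ->; rewrite ?orbT.
  rewrite !m0r ?mS //; case/andP: (Sz') => /qm[-> q2] _; split=> //.
  by apply: contra q2 => /eqP /rS -> //; rewrite ?mS.
Qed.

(* Hangs the handle [H] in the middle of the side [x]: the edge [x] is cut into
   [y] and [x] by the new vertex. *)
Definition attach_letter x y (H : seq T) z :=
  if z == x then y :: H ++ [:: x] else if z == bar x then [:: z; bar y] else [:: z].
Definition attach x y H w := flatten (map (attach_letter x y H) w).

Lemma attach_cat x y H A B : attach x y H (A ++ B) = attach x y H A ++ attach x y H B.
Proof. by rewrite /attach map_cat flatten_cat. Qed.

Lemma attach_cons x y H z B : attach x y H (z :: B) = attach_letter x y H z ++ attach x y H B.
Proof. by []. Qed.

Lemma attach_self x y H : attach_letter x y H x = y :: H ++ [:: x].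
Proof. by rewrite /attach_letter eqxx. Qed.

Lemma attach_bar x y H : attach_letter x y H (bar x) = [:: bar x; bar y].
Proof. by rewrite /attach_letter (negPf (barN x)) eqxx. Qed.

Lemma attach_other x y H z : z != x -> z != bar x -> attach_letter x y H z = [:: z].
Proof. by rewrite /attach_letter => /negPf-> /negPf->. Qed.

Lemma attach_notin x y H A : x \notin A -> bar x \notin A -> attach x y H A = A.
Proof.
elim: A => [//|z A IH]; rewrite !inE !negb_or => /andP[zx xA] /andP[zx' xA'].
by rewrite attach_cons attach_other 1?eq_sym // IH.
Qed.

Arguments attach : simpl never.

(** Each move lifts to a single one. If it uses the side [bar x], the lifted move uses [bar y]
    instead, so that the handle stays outside the exchanged block. *)
Lemma reach_attach n x y H w w' : uniq w -> reach n w w' ->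
  reaches n (eq (attach x y H w')) (attach x y H w).
Proof.
move=> u r; elim: r u => {n w w'} [n w|n U V w _ IH|n a A B c C D w _ IH] u.
- exact: reaches_here.
- by rewrite attach_cat; apply: reaches_rot; rewrite -attach_cat; apply: IH; rewrite uniq_catC.
have {}IH : reaches n (eq (attach x y H w)) (attach x y H (a :: C ++ bar a :: B ++ c :: A ++ bar c :: D)).
  apply: IH; rewrite -(perm_uniq (reach_perm (ReachMove (Reach0 0 _)))) //.
have ac : a != c by apply/eqP=> E; rewrite E in u; dup u c.
have a'c : bar a != c by apply/eqP=> E; rewrite -E in u; dup u (bar a).
have ac' : a != bar c by apply/eqP=> E; rewrite E in u; dup u (bar c).
have bb : bar a != bar c by rewrite (inj_eq (inv_inj barK)).
move: IH; rewrite !(attach_cons, attach_cat).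
case: (eqVneq a x) => [ax|ax].
  rewrite -ax attach_self attach_bar !attach_other 1?eq_sym // => IH.
  by rotate_to a; exchange a c; rotate_to y; move: IH; word_norm.
have [ax'|ax'] := eqVneq a (bar x).
  rewrite ax' barK in a'c bb *; rewrite ax' in ac ac'.
  rewrite attach_bar attach_self !attach_other 1?eq_sym // => IH.
  by exchange (bar y) c; rotate_to (bar x); move: IH; word_norm.
have xa : bar a != x by apply: contra_neq ax' => <-; rewrite barK.
have xa' : bar a != bar x by rewrite (inj_eq (inv_inj barK)).
rewrite (attach_other _ _ ax ax') (attach_other _ _ xa xa').
have [cx|cx] := eqVneq c x.
  rewrite -cx attach_self attach_bar => IH.
  by exchange a c; rotate_to a; move: IH; word_norm.
have [cx'|cx'] := eqVneq c (bar x).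
  rewrite cx' barK attach_bar attach_self => IH.
  by exchange a (bar y); rotate_to a; move: IH; word_norm.
have xc : bar c != x by apply: contra_neq cx' => <-; rewrite barK.
have xc' : bar c != bar x by rewrite (inj_eq (inv_inj barK)).
rewrite (attach_other _ _ cx cx') (attach_other _ _ xc xc') => IH.
by exchange a c; move: IH; word_norm.
Qed.

(** * Standard words *)

(* A torus [v b v' b'] with handles hung one after the other in the middle of its
   side [v]. *)
Fixpoint canon_tail b (l : seq (T * T * T * T)) : seq T :=
  if l is (y, p, c, q) :: l' then
    bar y :: canon_tail b l' ++ [:: y; p; c; bar p; q; bar c; bar q]
  else [:: bar b].
Definition canon v b l := v :: b :: bar v :: canon_tail b l.
Definition has_canon n w := exists v b l, size l = n /\ w = canon v b l.

Lemma reach_map (r : T -> T) n w w' : (forall z, r (bar z) = bar (r z)) ->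
  reach n w w' -> reach n (map r w) (map r w').
Proof.
move=> rb; elim=> {n w w'} [n w|n U V w _ IH|n x A B y C D w _ IH].
- exact: Reach0.
- by rewrite map_cat; apply: ReachRot; rewrite -map_cat.
- move: IH; rewrite /= !(map_cat, map_cons) !rb; exact: ReachMove.
Qed.

Lemma canon_map (r : T -> T) n w : (forall z, r (bar z) = bar (r z)) ->
  has_canon n w -> has_canon n (map r w).
Proof.
move=> rb [v [b [l [ln ->]]]].
exists (r v), (r b), [seq (r t.1.1.1, r t.1.1.2, r t.1.2, r t.2) | t <- l].
rewrite size_map; split=> //; rewrite /canon /= rb; do 3 congr cons.
elim: l {ln} => [|[[[y p] c] q] l IH] /=; first by rewrite rb.
by rewrite map_cat IH /= !rb.
Qed.

(** Standard words are considered up to names, so a renaming caused by a slide is harmless. *)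
Lemma reaches_canon_map (r : T -> T) k n w : (forall z, r (bar z) = bar (r z)) ->
  reaches k (has_canon n) w -> reaches k (has_canon n) (map r w).
Proof.
by move=> rb [w' rw cw]; exists (map r w'); [apply: reach_map | apply: canon_map].
Qed.

(* The two moves slide [H] to [z] but permute the names [x], [y], [z] cyclically. *)
Lemma slide_left k n x A B y H z C D :
  uniq (y :: H ++ x :: A ++ bar x :: bar y :: B ++ z :: C ++ bar z :: D) ->
  reaches k (has_canon n) (x :: A ++ bar x :: B ++ y :: H ++ z :: C ++ bar z :: bar y :: D) ->
  reaches k.+2 (has_canon n) (y :: H ++ x :: A ++ bar x :: bar y :: B ++ z :: C ++ bar z :: D).
Proof.
move=> u rk; exchange x z; exchange y z.
(* The word reached by the two moves is the image under [r] of the word in [rk]. *)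
pose r t := if t == x then y else if t == bar x then bar y else
  if t == y then z else if t == bar y then bar z else
  if t == z then x else if t == bar z then bar x else t.
have xy : x != y by apply/eqP=> E; rewrite E in u; dup u y.
have xz : x != z by apply/eqP=> E; rewrite E in u; dup u z.
have yz : y != z by apply/eqP=> E; rewrite E in u; dup u z.
have xy' : x != bar y by apply/eqP=> E; rewrite E in u; dup u (bar y).
have xz' : x != bar z by apply/eqP=> E; rewrite E in u; dup u (bar z).
have yz' : y != bar z by apply/eqP=> E; rewrite E in u; dup u (bar z).
have flip a c : (bar a == c) = (a == bar c) := can2_eq barK barK a c.
have binj a c : (bar a == bar c) = (a == c) := inj_eq (inv_inj barK) a c.
have ne := (negPf xy, negPf xz, negPf yz, negPf xy', negPf xz', negPf yz', flip, binj, barK,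
  (fun a => etrans (eq_sym a (bar a)) (negPf (barN a))), eqxx).
have rx : r x = y by rewrite /r eqxx.
have rx' : r (bar x) = bar y by rewrite /r !ne.
have ry : r y = z by rewrite /r ![y == _]eq_sym !ne.
have ry' : r (bar y) = bar z by rewrite /r !ne ![y == _]eq_sym !ne.
have rz : r z = x by rewrite /r ![z == _]eq_sym !ne.
have rz' : r (bar z) = bar x by rewrite /r !ne ![z == _]eq_sym !ne.
have rid t : t \in A ++ B ++ C ++ D ++ H -> r t = t.
  rewrite mem_count_mem => tw; rewrite /r.
  by do ![case: eqP => [E|_]; first by exfalso; rewrite E in tw;
    move: tw; match type of E with _ = ?a => move: (uniq_count_le1 u a) end; count_lia].
have rb t : r (bar t) = bar (r t).
  rewrite {2}/r; do ![case: eqP => [->|?]; first by rewrite ?barK ?rx ?rx' ?ry ?ry' ?rz ?rz' ?barK].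
  by rewrite /r !flip !barK; do ![case: eqP => // _].
have rmap S : {subset S <= A ++ B ++ C ++ D ++ H} -> map r S = S.
  by move=> sS; rewrite -[RHS]map_id; apply/eq_in_map=> a /sS/rid.
have := reaches_canon_map rb rk.
by rewrite /= !(map_cat, map_cons) /= ?map_cat ?map_cons rx rx' ry ry' rz rz' !rmap //;
  move=> a aS; rewrite !mem_cat aS ?orbT.
Qed.

(** The first move exchanges [A] and [C]; the second exchanges them back, carrying the handle along
    with [C]. No name changes. *)
Lemma slide_right k n x A B y H z C D :
  reaches k (has_canon n) (x :: A ++ bar x :: B ++ z :: bar y :: C ++ y :: H ++ bar z :: D) ->
  reaches k.+2 (has_canon n) (x :: bar y :: A ++ y :: H ++ bar x :: B ++ z :: C ++ bar z :: D).
Proof.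
move=> rk; exchange (bar y) z; exchange x z.
by move: rk; word_norm.
Qed.

Lemma attach_left s y H A B C :
  uniq (A ++ s :: B ++ bar s :: C) ->
  attach s y H (A ++ s :: B ++ bar s :: C) = A ++ y :: H ++ s :: B ++ bar s :: bar y :: C.
Proof.
move=> u; have ni S : {subset S <= A ++ B ++ C} -> attach s y H S = S.
  move=> sS; apply: attach_notin; apply/negP=> /sS; rewrite mem_count_mem => h; exfalso; move: h.
    by move: (uniq_count_le1 u s); count_lia.
  by move: (uniq_count_le1 u (bar s)); count_lia.
rewrite !(attach_cat, attach_cons) attach_self attach_bar !ni; first (by word_eq);
  by move=> z zS; rewrite !mem_cat zS ?orbT.
Qed.

Lemma attach_right s y H A B C :
  uniq (A ++ bar s :: B ++ s :: C) ->
  attach s y H (A ++ bar s :: B ++ s :: C) = A ++ bar s :: bar y :: B ++ y :: H ++ s :: C.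
Proof.
move=> u; have ni S : {subset S <= A ++ B ++ C} -> attach s y H S = S.
  move=> sS; apply: attach_notin; apply/negP=> /sS; rewrite mem_count_mem => h; exfalso; move: h.
    by move: (uniq_count_le1 u s); count_lia.
  by move: (uniq_count_le1 u (bar s)); count_lia.
rewrite !(attach_cat, attach_cons) attach_self attach_bar !ni; first (by word_eq);
  by move=> z zS; rewrite !mem_cat zS ?orbT.
Qed.

Definition handle p c q := [:: p; c; bar p; q; bar c; bar q].

Lemma canon_cons v b y p c q l :
  canon v b ((y, p, c, q) :: l) =
  v :: b :: bar v :: bar y :: canon_tail b l ++ y :: handle p c q.
Proof. by []. Qed.

Ltac reach_canon v b l :=
  rotate_to v; apply: reaches_here; exists v, b, l; split=> //;
  by rewrite /canon /handle; word_norm.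
Ltac uniq_permuted u :=
  refine (etrans (perm_uniq _) u); apply/seq.permP=> a; count_lia.

Lemma canon_site_base v b s y p c q (N := canon v b [::]) :
  uniq N -> s \in N -> reaches 0 (has_canon 1) (attach s y (handle p c q) N).
Proof.
rewrite /N /canon /= => u; rewrite !inE => /or4P[] /eqP ->.
- rewrite (@attach_left v y _ [::] [:: b] [:: bar b]) //.
  by reach_canon v b [:: (y, p, c, q)].
- rewrite (@attach_left b y _ [:: v] [:: bar v] [::]) //.
  by reach_canon b (bar v) [:: (y, p, c, q)].
- have := @attach_right (bar v) y (handle p c q) [::] [:: b] [:: bar b]; rewrite /= barK => -> //.
  by reach_canon (bar v) (bar b) [:: (y, p, c, q)].
- have := @attach_right (bar b) y (handle p c q) [:: v] [:: bar v] [::]; rewrite /= barK => -> //.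
  by reach_canon (bar b) v [:: (y, p, c, q)].
Qed.

(** A handle hung on a side of the outermost torus is slid once: onto [v] from the sides [p], [c],
    [q], and onto [y] from the opposite sides. *)
Lemma canon_site_torus v b y p c q l s y' p' c' q' H
    (N := canon v b ((y, p, c, q) :: l)) :
  H = handle p' c' q' -> uniq (attach s y' H N) -> uniq N -> s \in handle p c q ->
  reaches 2 (has_canon (size l).+2) (attach s y' H N).
Proof.
rewrite /N canon_cons /handle => HE u' u; set Q := canon_tail b l.
set W := (X in attach s y' H X).
have left x A B C : W = A ++ x :: B ++ bar x :: C ->
    attach x y' H W = A ++ y' :: H ++ x :: B ++ bar x :: bar y' :: C.
  by move=> E; rewrite E attach_left // -E.
have right x A B C : W = A ++ x :: B ++ bar x :: C ->
    attach (bar x) y' H W = A ++ x :: bar y' :: B ++ y' :: H ++ bar x :: C.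
  move=> E; rewrite E; have := @attach_right (bar x) y' H A B C; rewrite barK; apply.
  by rewrite -E.
(* On [v] the new handle becomes the outermost one ([l']); on [y] it comes just inside the old
   outermost one ([l'']). *)
pose l' := (y', p', c', q') :: (y, p, c, q) :: l.
pose l'' := (y, p, c, q) :: (y', p', c', q') :: l.
rewrite !inE => /or4P[/eqP E|/eqP E|/eqP E|/or3P[]/eqP E]; rewrite {s}E in u' *.
- move: u'; rewrite (left p (v :: b :: bar v :: bar y :: Q ++ [:: y]) [:: c] [:: q; bar c; bar q]); last by word_eq.
  move=> u'; rotate_to y'.
  have := @slide_left 0 (size l).+2 p [:: c] [:: q; bar c; bar q] y' H v [:: b] (bar y :: Q ++ [:: y]) ltac:(uniq_permuted u').
  by word_norm; apply; rewrite HE; reach_canon v b l'.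
- move: u'; rewrite (left c (v :: b :: bar v :: bar y :: Q ++ [:: y; p]) [:: bar p; q] [:: bar q]); last by word_eq.
  move=> u'; rotate_to y'.
  have := @slide_left 0 (size l).+2 c [:: bar p; q] [:: bar q] y' H v [:: b] (bar y :: Q ++ [:: y; p]) ltac:(uniq_permuted u').
  by word_norm; apply; rewrite HE; reach_canon v b l'.
- rewrite (right p (v :: b :: bar v :: bar y :: Q ++ [:: y]) [:: c] [:: q; bar c; bar q]); last by word_eq.
  rotate_to p.
  have := @slide_right 0 (size l).+2 p [:: c] [:: q; bar c; bar q; v; b; bar v] y' H (bar y) Q [::].
  by word_norm; apply; rewrite HE; reach_canon v b l''.
- move: u'; rewrite (left q (v :: b :: bar v :: bar y :: Q ++ [:: y; p; c; bar p]) [:: bar c] [::]); last by word_eq.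
  move=> u'; rotate_to y'.
  have := @slide_left 0 (size l).+2 q [:: bar c] [::] y' H v [:: b] (bar y :: Q ++ [:: y; p; c; bar p]) ltac:(uniq_permuted u').
  by word_norm; apply; rewrite HE; reach_canon v b l'.
- rewrite (right c (v :: b :: bar v :: bar y :: Q ++ [:: y; p]) [:: bar p; q] [:: bar q]); last by word_eq.
  rotate_to c.
  have := @slide_right 0 (size l).+2 c [:: bar p; q] [:: bar q; v; b; bar v] y' H (bar y) Q [:: p].
  by word_norm; apply; rewrite HE; reach_canon v b l''.
- rewrite (right q (v :: b :: bar v :: bar y :: Q ++ [:: y; p; c; bar p]) [:: bar c] [::]); last by word_eq.
  rotate_to q.
  have := @slide_right 0 (size l).+2 q [:: bar c] [:: v; b; bar v] y' H (bar y) Q [:: p; c; bar p].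
  by word_norm; apply; rewrite HE; reach_canon v b l''.
Qed.

(** If [s] is not a side of the outermost torus, neither is [bar s], so its edge is unlinked with
    that of [p1]. A first slide brings the handle to [p1] or [bar p1], and [canon_site_torus]
    performs the second. *)
Lemma canon_site v b l s y p c q H (N := canon v b l) :
  H = handle p c q -> uniq (attach s y H N) -> uniq N ->
  {in N, forall z, bar z \in N} -> s \in N ->
  reaches 4 (has_canon (size l).+1) (attach s y H N).
Proof.
rewrite /N; case: l {N} => [|[[[y1 p1] c1] q1] l] HE u' u cl sN.
  by apply: (reaches_leq (n := 0)) => //; rewrite HE; apply: canon_site_base.
have [sT|sT] := boolP (s \in handle p1 c1 q1).
  by apply: (reaches_leq (n := 2)) => //; apply: canon_site_torus HE _ _ sT.
have s'T : bar s \notin handle p1 c1 q1.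
  apply: contra sT; rewrite -{2}[s]barK !inE.
  by repeat case/orP; move=> /eqP->; rewrite ?barK eqxx ?orbT.
have NE : canon v b ((y1, p1, c1, q1) :: l) =
    (v :: b :: bar v :: bar y1 :: canon_tail b l ++ [:: y1]) ++ handle p1 c1 q1.
  by rewrite /canon /handle; word_eq.
have := canon_site_torus HE (v := v) (b := b) (y := y1) (p := p1) (c := c1) (q := q1) (l := l) (y' := y).
have {cl} s'N := cl s sN; rewrite {}NE in u u' sN s'N *.
move: sN s'N; rewrite !mem_cat (negPf sT) (negPf s'T) !orbF.
move: (v :: b :: _) u u' => V u u' sV s'V torus_site.
case/splitPr: sV u u' s'V torus_site => A B u u'.
have ss' : bar s != s := barN s.
rewrite mem_cat inE (negPf ss') /= => /orP[] /splitPr E.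
- case: E u u' => A1 B1 u u' torus_site.
  move: u'; rewrite -catA /= -catA /= attach_right; last by move: u; word_norm.
  rewrite /handle => u'; rotate_to (bar s).
  have := @slide_right 2 (size l).+2 (bar s) B1 (B ++ [::]) y H p1 [:: c1] ([:: q1; bar c1; bar q1] ++ A1).
  word_norm; apply.
  have := torus_site (bar p1).
  have := @attach_right (bar p1) y H (A1 ++ bar s :: B1 ++ s :: B) [:: c1] [:: q1; bar c1; bar q1].
  rewrite /handle; word_norm => -> //; last by move: u; word_norm.
  move=> site; rotate_to A1; apply: site.
  + by uniq_permuted u'.
  + by move: u; word_norm.
  + by rewrite !inE eqxx !orbT.
- case: E u u' => B1 C1 u u' torus_site.
  move: u'; rewrite -catA /= -catA /= attach_left; last by move: u; word_norm.
  rewrite /handle => u'; rotate_to y.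
  have := @slide_left 2 (size l).+2 s B1 C1 y H p1 [:: c1] ([:: q1; bar c1; bar q1] ++ A) ltac:(uniq_permuted u').
  word_norm; apply.
  have := torus_site p1.
  have := @attach_left p1 y H (A ++ s :: B1 ++ bar s :: C1) [:: c1] [:: q1; bar c1; bar q1].
  rewrite /handle; word_norm => -> //; last by move: u; word_norm.
  move=> site; rotate_to A; apply: site.
  + by uniq_permuted u'.
  + by move: u; word_norm.
  + by rewrite !inE eqxx ?orbT.
Qed.

Lemma good_reaches_canon n w : good w -> size w = 8 * n + 4 -> reaches (9 * n) (has_canon n) w.
Proof.
elim: n w => [|n IH] w gw sw.
  case: w gw sw => [|a [|b [|c [|d [|]]]]] // [u cl [m fm qm]] _.
  have ma : m (bar a) = b by apply: (fcycle_next (A := [::]) (B := [:: c; d]) fm).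
  have mb : m (bar b) = c by apply: (fcycle_next (A := [:: a]) (B := [:: d]) fm).
  have mc : m (bar c) = d by apply: (fcycle_next (A := [:: a; b]) (B := [::]) fm).
  have md : m (bar d) = a by apply: (fcycle_last (A := [:: b; c]) fm).
  (* If consecutive letters were partners, [m] would fix the second; so opposite letters are
     paired. *)
  have nofix z : z \in [:: a; b; c; d] -> m z <> z by move=> /qm[_ +] E; rewrite !E eqxx.
  have a'b : bar a != b by apply/eqP=> E; apply: (nofix b); rewrite ?inE ?eqxx ?orbT // -{1}E.
  have b'c : bar b != c by apply/eqP=> E; apply: (nofix c); rewrite ?inE ?eqxx ?orbT // -{1}E.
  have d'a : bar d != a by apply/eqP=> E; apply: (nofix a); rewrite ?inE ?eqxx ?orbT // -{1}E.
  have ac : bar a = c.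
    have := cl a (mem_head _ _); rewrite !inE (negPf (barN a)) (negPf a'b) /=.
    by case/orP=> /eqP // E; rewrite -E barK eqxx in d'a.
  have bd : bar b = d.
    have := cl b; rewrite !inE eqxx orbT => /(_ isT); rewrite (negPf (barN b)) (negPf b'c) /=.
    case/orP=> /eqP // E; have := congr1 bar E; rewrite barK ac => bc.
    by rewrite bc in u; dup u c.
  by apply: reaches_here; exists a, b, [::]; rewrite /canon /= ac bd.
(* Two moves create a loop, three a handle, [9 * n] standardize the rest, and four put the handle in
   place. *)
have -> : 9 * n.+1 = 2 + (3 + (9 * n + 4)) by lia.
apply: (reaches_bind gw (good_reaches_loop gw _)) => //; first by case: (w) sw.
move=> w1 gw1 sw1 lw1.
apply: (reaches_bind gw1 (good_reaches_torus gw1 lw1 _)) => //; first by rewrite sw1 sw; lia.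
move=> w2 gw2 sw2 [p [b [q [V wE]]]].
have V0 : V != [::] by apply/eqP=> VE; move: sw2; rewrite sw1 sw wE VE /=; lia.
rewrite wE in gw2 sw2 *.
have [v [P [y [Q VE]]]] := torus_corners gw2 V0.
rewrite {}VE {V V0 wE} in gw2 sw2 *.
have gW : good (y :: handle p b q ++ v :: P ++ bar v :: bar y :: Q).
  have gW : good (v :: P ++ bar v :: bar y :: Q ++ y :: handle p b q).
    by have := good_rot gw2; rewrite /handle; word_norm.
  have E : v :: P ++ bar v :: bar y :: Q ++ y :: handle p b q =
    (v :: P ++ bar v :: bar y :: Q) ++ y :: handle p b q by word_eq.
  by have := gW; rewrite E => /good_rot; word_norm.
(* Detaching removes eight letters: the six of the handle, [y] and [bar y]. *)
have gw0 : good (v :: P ++ bar v :: Q).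
  apply: (good_detach (p := p) (b := b) (q := q) (y := y)).
  by have := good_rot gw2; word_norm.
have sw0 : size (v :: P ++ bar v :: Q) = 8 * n + 4.
  by move: sw2; rewrite sw1 sw; word_norm; rewrite !size_cat /= !size_cat /=; lia.
have [w0' rw0 cw0] := IH _ gw0 sw0.
have [u0' cl0' _] := reach_good rw0 gw0.
(* The handle stays on [v] during the lifted moves, but [v] may end up as any side of the standard
   word, hence the use of [canon_site]. *)
have := fun u => reach_attach v y (handle p b q) u rw0; case: (gw0) => u0 _ _ /(_ u0).
rewrite (@attach_left v y _ [::]) // => rW.
have -> : [:: p; b; bar p; q; bar b; bar q] ++ v :: P ++ bar v :: bar y :: Q ++ [:: y] =
  (handle p b q ++ v :: P ++ bar v :: bar y :: Q) ++ [:: y] by rewrite /handle; word_eq.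
apply: reaches_rot; apply: (reaches_bind gW rW) => W gw' _ WE.
rewrite -{}WE {W} in gw' *; case: gw' => uW _ _.
have vw0' : v \in w0' by rewrite -(perm_mem (reach_perm rw0)) mem_head.
case: cw0 uW u0' cl0' vw0' => v' [b' [l [<- ->]]] uW u0' cl0' vw0'.
exact: canon_site.
Qed.

End Words.

(** * From words to collections *)

Lemma canon_closed (T : eqType) (bar : T -> T) v b l : involutive bar ->
  {in canon bar v b l, forall z, bar z \in canon bar v b l}.
Proof.
move=> barK; have [b'l tail] : bar b \in canon_tail bar b l /\
    {in canon_tail bar b l, forall z, z = bar b \/ bar z \in canon_tail bar b l}.
  elim: l => [|[[[y p] c] q] l [b'l IH]] /=.
    by split=> [|z]; rewrite inE // => /eqP; left.
  split=> [|z]; first by rewrite inE mem_cat b'l orbT.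
  rewrite inE mem_cat => /or3P[/eqP->|/IH[->|zl]|zT].
  - by right; rewrite barK !(inE, mem_cat) eqxx !orbT.
  - by left.
  - by right; rewrite inE mem_cat zl orbT.
  - by right; move: zT; rewrite !inE; repeat case/orP; move=> /eqP->; rewrite ?barK !(inE, mem_cat) eqxx ?orbT.
move=> z; rewrite !inE => /or4P[/eqP->|/eqP->|/eqP->|/tail[->|zl]].
- by rewrite eqxx !orbT.
- by rewrite b'l !orbT.
- by rewrite barK eqxx.
- by rewrite barK eqxx orbT.
- by rewrite zl !orbT.
Qed.

(** The zipped word is standard for the product involution, so [canon_closed] applied to it shows
    that matching the letters by position respects edges. *)
Lemma canon_zip (T1 T2 : eqType) (bar1 : T1 -> T1) (bar2 : T2 -> T2) v1 b1 l1 v2 b2 l2 :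
  size l1 = size l2 -> exists l,
  zip (canon bar1 v1 b1 l1) (canon bar2 v2 b2 l2) =
  canon (fun z => (bar1 z.1, bar2 z.2)) (v1, v2) (b1, b2) l.
Proof.
move=> sl; suff [l E] : exists l, size (canon_tail bar1 b1 l1) = size (canon_tail bar2 b2 l2) /\
    zip (canon_tail bar1 b1 l1) (canon_tail bar2 b2 l2) =
    canon_tail (fun z => (bar1 z.1, bar2 z.2)) (b1, b2) l.
  by exists l; rewrite /canon /= E.2.
elim: l1 l2 sl => [|[[[y1 p1] c1] q1] l1 IH] [|[[[y2 p2] c2] q2] l2] //= sl.
  by exists [::].
case: sl => sl; have [l [sE E]] := IH _ sl; exists (((y1, y2), (p1, p2), (c1, c2), (q1, q2)) :: l).
by rewrite zip_cat //= E !size_cat sE.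
Qed.

(** * Boundary words of one-faced collections *)

Section Bridge.
Variable D : finType.
Implicit Types (G H : emap D) (w : seq D).

Lemma homeo_class_eq G H : homeo G H -> homeo_class G = homeo_class H.
Proof.
move=> GH; apply/setP=> K; rewrite !inE; apply/idP/idP; apply: homeo_trans => //.
exact: homeo_sym.
Qed.

Definition conj_map G (f : {perm D}) : emap D := ((edge G ^ f)%g, (node G ^ f)%g).

Lemma homeo_conj G f : homeo G (conj_map G f).
Proof. by apply/existsP; exists f; rewrite !eqxx. Qed.

Lemma porbit_conj (s f : {perm D}) x : porbit (s ^ f)%g (f x) = f @: porbit s x.
Proof.
apply/setP=> y; apply/porbitP/imsetP => [[i ->]|[_ /porbitP[i ->] ->]].
  by exists ((s ^+ i)%g x); [exact: mem_porbit | rewrite -conjXg permJ].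
by exists i; rewrite -conjXg permJ.
Qed.

Lemma card_porbits_conj (s f : {perm D}) : #|porbits (s ^ f)%g| = #|porbits s|.
Proof.
rewrite /porbits -(card_imset (porbit s @: D) (imset_inj (@perm_inj _ f))).
congr #|pred_of_set _|; apply/setP=> P; apply/imsetP/imsetP => [[x _ ->]|[_ /imsetP[x _ ->] ->]].
  by exists (porbit s (f^-1%g x)); [exact: imset_f | rewrite -porbit_conj permKV].
by exists (f x); rewrite ?porbit_conj.
Qed.

Lemma one_faced_conj G f : one_faced G -> one_faced (conj_map G f).
Proof.
case/andP=> /andP[/forallP eG /forallP nG] f1; apply/andP; split; last first.
  by rewrite /face /= -conjVg -conjMg card_porbits_conj.
apply/andP; split; apply/forallP=> z; rewrite -[z](permKV f).
  by rewrite /= !permJ !(inj_eq perm_inj).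
by rewrite /= porbit_conj card_imset ?nG //; exact: perm_inj.
Qed.

(* [w] lists the sides of the polygon in the order in which they are met. *)
Definition face_word G w := [/\ uniq w, w =i D & fcycle (face G) w].

Lemma one_faced_word G : one_faced G -> exists w, face_word G w.
Proof.
case/andP=> _ /cards1P[P PE].
have [x _] : exists2 x, x \in D & porbit (face G) x = P.
  by have := set11 P; rewrite -PE => /imsetP[x xD ->]; exists x.
exists (fingraph.orbit (face G) x); split; first exact: orbit_uniq.
  move=> y; rewrite -fconnect_orbit inE.
  have : porbit (face G) y == porbit (face G) x.
    have mem z : porbit (face G) z = P by apply/set1P; rewrite -PE imset_f.
    by rewrite !mem.
  rewrite eq_porbit_mem => /porbitP[i ->]; rewrite permX; exact: fconnect_iter.
exact: (cycle_orbit perm_inj).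
Qed.

Lemma word_one_faced G w : curve_collection G -> face_word G w -> w != [::] -> one_faced G.
Proof.
move=> cG [u mw fw]; case: w u mw fw => // x w u mw fw _.
rewrite /one_faced cG; apply/cards1P; exists (porbit (face G) x).
apply/setP=> P; rewrite inE; apply/imsetP/eqP => [[y _ ->]|->]; last by exists x.
apply/eqP; rewrite eq_porbit_mem.
have yw : y \in x :: w by rewrite mw.
have := fconnect_cycle fw (mem_head x w) y; rewrite yw => /iter_findex <-.
by rewrite -permX mem_porbit.
Qed.

Lemma curve_edgeK G : curve_collection G -> involutive (edge G).
Proof. by case/andP=> /forallP eG _ x; case/andP: (eG x) => /eqP. Qed.

Lemma curve_edgeN G : curve_collection G -> forall x, edge G x != x.
Proof. by case/andP=> /forallP eG _ x; case/andP: (eG x). Qed.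

Lemma face_word_good G w : curve_collection G -> face_word G w -> good (edge G) w.
Proof.
move=> cG [u mw fw]; split=> //; first by move=> x _; rewrite mw.
exists (node G)^-1%g.
  by rewrite (eq_fcycle (f' := face G)) // => x; rewrite /= faceE.
move=> x _; case/andP: cG => _ /forallP/(_ x)/eqP n4.
set m := (node G)^-1%g.
have m4 : #|porbit m x| = 4 by rewrite porbitV.
have := iter_porbit m x; have := uniq_traject_porbit m x; rewrite m4 /= => + ->.
by rewrite !inE !negb_or => /and4P[/and3P[_ + _] _ _ _]; rewrite eq_sym.
Qed.

(** Conjugating the surgery by the transposition [t] yields a homeomorphic collection with the
    original [edge], so that successive moves share one involution. *)
Lemma face_word_move G x A B y C E :
  curve_collection G ->
  face_word G (x :: A ++ edge G x :: B ++ y :: C ++ edge G y :: E) ->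
  exists H, [/\ edge H = edge G, curve_collection H,
    face_word H (x :: C ++ edge G x :: B ++ y :: A ++ edge G y :: E)
    & is_surgery G (surgery G x y) /\ homeo (surgery G x y) H].
Proof.
move=> cG wG; case: (wG) => u mw fw.
pose t := tperm (edge G x) (edge G y).
pose H : emap D := (edge G, (node G ^ t)%g).
have KH : surgery G x y = conj_map H t.
  by rewrite /conj_map /= -conjgM tperm2 conjg1.
have cH : curve_collection H.
  case/andP: cG => eG /forallP nG; apply/andP; split=> //; apply/forallP=> z.
  by rewrite -[z](permKV t) /= porbit_conj card_imset ?nG //; exact: perm_inj.
have wH : face_word H (x :: C ++ edge G x :: B ++ y :: A ++ edge G y :: E).
  have pw := perm_move x A (edge G x) B y C (edge G y) E.
  split; first by rewrite -(perm_uniq pw).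
    by move=> z; rewrite -(perm_mem pw).
  have := fcycle_move (curve_edgeK cG) (curve_edgeN cG) (m := (node G)^-1%g) u.
  rewrite (eq_fcycle (f' := face G)) => [/(_ fw)|z]; last by rewrite /= faceE.
  rewrite (eq_fcycle (f' := face H)) // => z.
  rewrite faceE /= -conjVg.
  have tE a : transpose (edge G x) (edge G y) a = t a by rewrite /t permE.
  by rewrite !tE -[in RHS](tpermK (edge G x) (edge G y) (edge G z)) permJ.
have oH : one_faced H by apply: word_one_faced cH wH _.
exists H; split=> //; split; last first.
  by rewrite KH; apply: homeo_sym; exact: homeo_conj.
rewrite /is_surgery (word_one_faced cG wG) // KH one_faced_conj //= -KH.
apply/existsP; exists x; apply/existsP; exists y; rewrite eqxx andbT.
apply/andP; split; apply/eqP=> e; rewrite e in u; [dup u x | dup u (edge G x)].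
Qed.

(** The matching [h] of the two words by position commutes with [edge] by [canon_zip] and with
    [face] because it preserves successors; [node] is determined by these two. *)
Lemma canon_homeo G1 G2 v1 b1 l1 v2 b2 l2
    (w1 := canon (edge G1) v1 b1 l1) (w2 := canon (edge G2) v2 b2 l2) :
  curve_collection G1 -> curve_collection G2 -> face_word G1 w1 -> face_word G2 w2 ->
  size l1 = size l2 -> homeo G1 G2.
Proof.
move=> c1 c2 [u1 m1 f1] [u2 m2 f2] sl.
have sw : size w1 = size w2.
  by rewrite -(card_uniqP u1) -(card_uniqP u2); apply: eq_card => z; rewrite m1 m2.
pose h z := nth z w2 (index z w1).
have hw : map h w1 = w2.
  apply: (@eq_from_nth _ v1) => [|i]; rewrite size_map // => iw.
  by rewrite (nth_map v1) // /h index_uniq //; apply: set_nth_default; rewrite -sw.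
have hinj : injective h.
  have iw z : index z w1 < size w2 by rewrite -sw index_mem m1.
  move=> x y; rewrite /h (set_nth_default y) // => /eqP; rewrite nth_uniq // => /eqP E.
  by rewrite -[x](@nth_index _ x x w1) ?m1 // E nth_index // m1.
have he z : edge G2 (h z) = h (edge G1 z).
  have [l E] := canon_zip (edge G1) (edge G2) v1 b1 v2 b2 sl.
  have zipE : zip w1 w2 = [seq (x, h x) | x <- w1] by rewrite -hw -{1}[w1]map_id zip_map.
  have : (z, h z) \in zip w1 w2 by rewrite zipE; apply: map_f; rewrite m1.
  rewrite E => /canon_closed /=; rewrite -E zipE => /(_ _)/mapP[] => [u|x _ [<-] //].
  by case: u => a c /=; rewrite !curve_edgeK.
have hf z : face G2 (h z) = h (face G1 z).
  have zw : z \in w1 by rewrite m1.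
  rewrite -(nextE f1 zw) -next_map // hw.
  by rewrite (nextE f2) // m2.
pose f := perm hinj.
have fe : edge G2 = (edge G1 ^ f)%g.
  by apply/permP=> z; rewrite -[z](permKV f) permJ !permE he.
have ff : face G2 = (face G1 ^ f)%g.
  by apply/permP=> z; rewrite -[z](permKV f) permJ 2!(permE hinj) hf.
apply/existsP; exists f; rewrite fe eqxx /=; apply/orP; left; apply/eqP.
have nodeE G : node G = ((face G)^-1 * edge G)%g by rewrite /face invMg invgK mulgKV.
by rewrite (nodeE G2) (nodeE G1) conjMg conjVg -ff -fe.
Qed.

End Bridge.

(** * Distances in the surgery graph *)

Section Distance.
Variable g : nat.
Notation D := (oriented_edge g).
Implicit Types (G H : emap D) (C : surgery_vertex g).

Lemma vertex_of G : one_faced G -> exists C, val C = homeo_class G.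
Proof.
move=> oG; have cG : homeo_class G \in collection_classes g by apply: imset_f.
by exists (Sub (homeo_class G) cG).
Qed.

Lemma vertexP C : exists2 G, one_faced G & val C = homeo_class G.
Proof. by case/imsetP: (valP C) => G oG E; exists G. Qed.

Lemma surgery_adj_sym : symmetric (@surgery_adj g).
Proof.
move=> C1 C2; rewrite /surgery_adj eq_sym; congr (_ && _).
by apply/existsP/existsP => [] [G /andP[G1 /existsP[H /andP[H2 r]]]];
  exists H; rewrite H2; apply/existsP; exists G; rewrite G1 orbC.
Qed.

(** Each move is an edge of the graph or stays in the same class. Adjacency excludes the latter, so
    such moves are dropped and the path may be shorter than [n]. *)
Lemma reach_path (e : {perm D}) n w w' : reach e n w w' ->
  forall G C, edge G = e -> curve_collection G -> face_word G w -> val C = homeo_class G ->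
  exists p H, [/\ edge H = e, curve_collection H, face_word H w',
    path (@surgery_adj g) C p /\ size p <= n & val (last C p) = homeo_class H].
Proof.
elim=> {n w w'} [n w|n U V w _ IH|n x A B y C0 E w _ IH] G C eG cG wG CG.
- by exists [::], G.
- case: wG => u mw fw; apply: IH eG cG _ CG; split; first by rewrite uniq_catC.
    by move=> z; rewrite -mw !mem_cat orbC.
  by rewrite cycle_catC.
rewrite -eG in wG; have [H [eH cH wH [sGH hH]]] := face_word_move cG wG.
have [C1 C1K] : exists C1, val C1 = homeo_class (surgery G x y).
  by apply: vertex_of; case/and3P: sGH.
have C1H : val C1 = homeo_class H by rewrite C1K; apply: homeo_class_eq.
rewrite eG in eH wH.
have [p [H' [eH' cH' wH' [adj sp] last_p]]] := IH H C1 eH cH wH C1H.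
have [CC1|CC1] := eqVneq C C1.
  by exists p, H'; split=> //; rewrite CC1 //; split=> //; apply: leqW.
exists (C1 :: p), H'; split=> //=; rewrite ltnS adj andbT; split=> //.
rewrite /surgery_adj CC1; apply/existsP; exists G; rewrite CG inE homeo_refl /=.
by apply/existsP; exists (surgery G x y); rewrite C1K inE homeo_refl sGH.
Qed.

Lemma vertex_to_canon n C : 8 * g - 4 = 8 * n + 4 ->
  exists p G v b l, [/\ curve_collection G, face_word G (canon (edge G) v b l), size l = n,
    path (@surgery_adj g) C p /\ size p <= 9 * n & val (last C p) = homeo_class G].
Proof.
move=> Dn; have [G oG CG] := vertexP C; have [w wG] := one_faced_word oG.
have cG : curve_collection G by case/andP: oG.
have sw : size w = 8 * n + 4.
  by case: wG => u mw _; rewrite -(card_uniqP u) (eq_card mw) card_ord.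
have [w' r [v [b [l [ln wE]]]]] := good_reaches_canon (curve_edgeK cG) (curve_edgeN cG) (face_word_good cG wG) sw.
have [p [H [eH cH wH pp lp]]] := reach_path r erefl cG wG CG.
by exists p, H, v, b, l; split=> //; rewrite eH -wE.
Qed.

Lemma dist_leq C1 C2 p k : path (@surgery_adj g) C1 p -> last C1 p = C2 -> size p <= k ->
  (dist (@surgery_adj g) C1 C2 <= (k%:Z)%:E)%E.
Proof.
move=> pp lp sp; rewrite /dist; case: {-}_ / idP => [c|[]]; last first.
  by apply/connectP; exists p.
case: ex_minnP => m _ /(_ (size p)) le_m; rewrite lee_fin lez_nat.
apply: leq_trans sp; apply: le_m; apply/existsP; exists (in_tuple p).
by rewrite pp lp eqxx.
Qed.

Lemma surgery_dist_leq n C1 C2 : 8 * g - 4 = 8 * n + 4 ->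
  (dist (@surgery_adj g) C1 C2 <= (18 * n)%:Z%:E)%E.
Proof.
move=> Dn.
have [p1 [G1 [v1 [b1 [l1 [c1 w1 s1 [pp1 sp1] lp1]]]]]] := vertex_to_canon C1 Dn.
have [p2 [G2 [v2 [b2 [l2 [c2 w2 s2 [pp2 sp2] lp2]]]]]] := vertex_to_canon C2 Dn.
have l12 : last C1 p1 = last C2 p2.
  apply: val_inj; rewrite lp1 lp2; apply: homeo_class_eq.
  by apply: canon_homeo c1 c2 w1 w2 _; rewrite s1 s2.
(* The second path is run backwards; [belast] drops the common end and keeps [C2], which becomes the
   last vertex. *)
apply: (@dist_leq _ _ (p1 ++ rev (belast C2 p2))).
- rewrite cat_path pp1 l12 rev_path; apply: sub_path pp2 => a c.
  by rewrite /= surgery_adj_sym.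
- by rewrite last_cat l12; case: (p2) => //= a s; rewrite rev_cons last_rcons.
- by rewrite size_cat size_rev size_belast; lia.
Qed.

End Distance.

Theorem theorem3 (g : nat) (hg : (1 <= g)%N) :
  (surgery_diameter g <= (3 * g%:Z ^+ 2 + 9 * g%:Z - 12)%R%:E)%E.
Proof.
(* The difference of the two sides is [3 * (g - 1) * (g - 2)], nonnegative for every integer
   [g >= 1]. *)
have bound : ((18 * g.-1)%:Z%:E <= (3 * g%:Z ^+ 2 + 9 * g%:Z - 12)%R%:E)%E.
  by rewrite lee_fin; nia.
apply: bigmax_le => [|C1 _]; first by apply: le_trans bound; rewrite lee_fin.
apply: bigmax_le => [|C2 _]; first by apply: le_trans bound; rewrite lee_fin.
by apply: le_trans bound; apply: surgery_dist_leq; lia.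
Qed.
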